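(* Let $\Omega=\mathbb{R}^2\setminus\{(r,1)\mid r\neq 0\}$. Let $(M^n,g)$ be a Hermitian manifold (not necessarily compact) whose canonical connections $D^r_{s}$ and $D^{r'}_{s'}$ are both Kähler-like, where $(r,s)$ and $(r',s')$ are distinct points of $\Omega$. If the (unordered) pair of connections is not one of the pairs $\{\nabla,\nabla'\}$, $\{\nabla^+,\nabla^-\}$, $\{\nabla^+,\nabla^s\}$, $\{\nabla^-,\nabla^s\}$ — that is, if the unordered pair $\{(r,s),(r',s')\}$ is none of $\{(0,1),(0,-1)\}$, $\{(-1,2),(\frac13,-2)\}$, $\{(-1,2),(-1,0)\}$, $\{(\frac13,-2),(-1,0)\}$ — then $g$ must be Kähler.
   Context: Let $(M^n,g)$ be a Hermitian manifold with complex structure $J$ and Riemannian (Levi-Civita) connection $\nabla$. The Chern connection $\nabla^c$ is the unique connection $D$ with $Dg=0$, $DJ=0$ whose torsion has no $(1,1)$-component. The Strominger (Bismut) connection $\nabla^s$ is the unique connection $D$ with $Dg=0$, $DJ=0$ whose torsion is totally skew-symmetric (i.e. $g(T^D(x,y),z)$ is a $3$-form). For $r\in\mathbb{R}$ the Gauduchon connection is $D^{r}=\frac{1+r}{2}\nabla^c+\frac{1-r}{2}\nabla^s$, and the canonical $(r,s)$-connection is $D^r_s=(1-s)D^r+s\nabla$. Special cases: $\nabla=D^0_1$, the anti-Riemannian connection $\nabla'=D^0_{-1}$, $\nabla^s=D^{-1}_0$, $\nabla^+=D^{-1}_2$, $\nabla^-=D^{1/3}_{-2}$. A connection $D$ with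 $Dg=0$ (not necessarily $DJ=0$) is called Kähler-like if its curvature tensor $R^D(x,y,z,w)=g(R^D(x,y)z,w)$ satisfies, for all real tangent vectors $x,y,z,w$: $R^D(x,y,z,w)+R^D(y,z,x,w)+R^D(z,x,y,w)=0$ and $R^D(Jx,Jy,z,w)=R^D(x,y,z,w)=R^D(x,y,Jz,Jw)$. *)

(* Defs.v *)
From HB Require Import structures.
From mathcomp Require Import all_boot all_order all_algebra.
From mathcomp Require Import all_classical all_reals all_analysis.
From mathcomp Require Import ring lra.
Set Implicit Arguments.
Unset Strict Implicit.
Unset Printing Implicit Defensive.
Import Order.TTheory GRing.Theory Num.Theory.
Import numFieldNormedType.Exports.
Local Open Scope classical_set_scope.
Local Open Scope ring_scope.

Section SmoothFunctions.
Context {R : realType} {E W : normedModType R}.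

(* Being C^k on V, for V open. *)
Fixpoint Ck (k : nat) (V : set E) (f : E -> W) : Prop :=
  if k is k'.+1 then
    (forall x, V x -> differentiable f x) /\
    (forall v, Ck k' V (fun x => 'D_v f x))
  else forall x, V x -> {for x, continuous f}.

Definition smooth_on (V : set E) (f : E -> W) : Prop :=
  forall k, Ck k V f.

Lemma near_eq_differentiable (f g : E -> W) (x : E) :
  (\near x, f x = g x) -> differentiable f x -> differentiable g x.
Proof.
move=> fg df.
have fgx : f x = g x by exact: nbhs_singleton fg.
have fg0 : \forall h \near (0 : E), f (h + x) = g (h + x).
  have sx : h + x @[h --> (0 : E)] --> x.
    have : continuous (shift x : E -> E).
      by move=> h; exact: differentiable_continuous.
    by move=> /(_ 0); rewrite /continuous_at /= add0r.
  exact: (sx _ fg).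
have /eqaddoP dfo := diff_locally df.
have dgo : g \o shift x = cst (g x) + 'd f x +o_ (0 : E) id.
  apply/eqaddoP => e e0; have := dfo _ e0; apply: filterS2 fg0 => h fgh.
  by rewrite !fctE /= -fgh -fgx.
have [cdf _] := (diff_locallyP x f).1 df.
by apply/diff_locallyP; rewrite (diff_unique cdf dgo).
Qed.

Lemma Ck_lincomb k (V : set E) (f g h : E -> W)
    (a b : R) : open V ->
  (forall x, V x -> h x = a *: f x + b *: g x) ->
  Ck k V f -> Ck k V g -> Ck k V h.
Proof.
move=> oV.
have nearV (f' g' : E -> W) x : (forall x, V x -> f' x = g' x) ->
    V x -> \forall y \near x, f' y = g' y.
  move=> fg Vx; have := open_nbhs_nbhs (conj oV Vx : open_nbhs x V).
  by apply: filterS => y; exact: fg.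
elim: k f g h => [|k IH] f g h hE /=.
  move=> cf cg x Vx.
  have nE := nearV _ _ x hE Vx.
  rewrite /prop_for /continuous_at (hE x Vx).
  apply: (@cvg_trans _ ((a *: f y + b *: g y) @[y --> x])).
    by apply: near_eq_cvg; move: nE; apply: filterS => y ->.
  by apply: cvgD; apply: cvgZl_tmp; [exact: cf|exact: cg].
move=> [df Df] [dg Dg]; split=> [x Vx|v].
  have dh : differentiable (a *: f + b *: g) x.
    by apply: differentiableD; apply: differentiableZ; [exact: df|exact: dg].
  apply: near_eq_differentiable dh.
  by have := nearV _ _ x hE Vx; apply: filterS => y ->.
apply: (IH _ _ _ _ (Df v) (Dg v)) => x Vx.
have fx : derivable f x v by apply: diff_derivable; exact: df.
have gx : derivable g x v by apply: diff_derivable; exact: dg.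
rewrite (near_eq_derive _ (nearV _ _ _ hE Vx)).
have -> : (fun y => a *: f y + b *: g y) = a *: f + b *: g by [].
by rewrite deriveD ?deriveZ //; exact: derivableZ.
Qed.

End SmoothFunctions.

(* C^n is modelled on R^{2n}: the row vector [x y] stands for x + iy. *)
Notation Cspace R n := 'rV[R]_(n + n).

Section LocalCalculus.
Context {R : realType} {n : nat}.
Local Notation E := (Cspace R n).

(* Multiplication by i. In holomorphic coordinates it is also the (constant)
   matrix of the complex structure J of a complex manifold. *)
Definition Jmap (u : E) : E := row_mx (- rsubmx u) (lsubmx u).

Definition bilinear2 (W : lmodType R) (b : E -> E -> W) : Prop :=
  (forall u, linear (b u)) /\ (forall v, linear (b ^~ v)).

(* Complex differentiability at each point, written as real differentiability
   plus the Cauchy-Riemann equations. *)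
Definition holomorphic_on (V : set E) (f : E -> E) : Prop :=
  forall x, V x -> differentiable f x /\
    forall u, 'D_(Jmap u) f x = Jmap ('D_u f x).

End LocalCalculus.

(* A complex manifold of complex dimension n, given by a holomorphic atlas.
   The values of [chart i] outside [chart_dom i], and of [chart_inv i] outside
   [chart_img i], are irrelevant. *)
Record complexManifold (R : realType) (n : nat) := ComplexManifold {
  points :> topologicalType;
  points_hausdorff : hausdorff_space points;
  points_second_countable : @second_countable points;
  chart_idx : Type;
  chart_dom : chart_idx -> set points;
  chart_img : chart_idx -> set (Cspace R n);
  chart : chart_idx -> points -> Cspace R n;
  chart_inv : chart_idx -> Cspace R n -> points;
  chart_dom_open : forall i, open (chart_dom i);
  chart_img_open : forall i, open (chart_img i);
  chart_sub : forall i p, chart_dom i p -> chart_img i (chart i p);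
  chart_inv_sub : forall i x, chart_img i x -> chart_dom i (chart_inv i x);
  chartK : forall i p, chart_dom i p -> chart_inv i (chart i p) = p;
  chart_invK : forall i x, chart_img i x -> chart i (chart_inv i x) = x;
  chart_continuous : forall i, {within chart_dom i, continuous (chart i)};
  chart_inv_continuous :
    forall i, {within chart_img i, continuous (chart_inv i)};
  chart_cover : forall p, exists i, chart_dom i p;
  transition_holomorphic : forall i j,
    holomorphic_on (chart_img i `&` chart_inv i @^-1` chart_dom j)
                   (chart j \o chart_inv i)
}.

Section Transition.
Context {R : realType} {n : nat} {M : complexManifold R n}.

Definition overlap (i j : chart_idx M) : set (Cspace R n) :=
  chart_img i `&` chart_inv i @^-1` chart_dom j.

Definition transition (i j : chart_idx M) : Cspace R n -> Cspace R n :=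
  chart j \o chart_inv i.

End Transition.

(* A Hermitian metric, as a real symmetric 2-tensor: [g i x u v] is its value
   on the tangent vectors with coordinates u and v, at the point of coordinate
   x in the i-th chart. *)
Record hermitianMetric (R : realType) (n : nat) (M : complexManifold R n) :=
  HermitianMetric {
  metric :> chart_idx M -> Cspace R n -> Cspace R n -> Cspace R n -> R;
  metric_bilinear : forall i x, chart_img i x -> bilinear2 (metric i x);
  metric_smooth : forall i u v,
    smooth_on (chart_img i) (fun x => metric i x u v);
  metric_sym : forall i x u v, chart_img i x ->
    metric i x u v = metric i x v u;
  metric_pos : forall i x u, chart_img i x -> u != 0 -> 0 < metric i x u u;
  metric_J : forall i x u v, chart_img i x ->
    metric i x (Jmap u) (Jmap v) = metric i x u v;
  metric_change : forall i j x u v, overlap i j x ->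
    metric j (transition i j x) ('D_u (transition i j) x)
             ('D_v (transition i j) x) = metric i x u v
}.

(* An affine connection on the real tangent bundle, given by its Christoffel
   symbols: [D i x u v] is the covariant derivative at x, along u, of the
   vector field with constant coordinates v in the i-th chart. *)
Record connection (R : realType) (n : nat) (M : complexManifold R n) :=
  Connection {
  christoffel :> chart_idx M ->
    Cspace R n -> Cspace R n -> Cspace R n -> Cspace R n;
  christoffel_bilinear : forall i x, chart_img i x ->
    bilinear2 (christoffel i x);
  christoffel_smooth : forall i u v,
    smooth_on (chart_img i) (fun x => christoffel i x u v);
  christoffel_change : forall i j x u v, overlap i j x ->
    'D_(christoffel i x u v) (transition i j) x =
    christoffel j (transition i j x) ('D_u (transition i j) x)
                  ('D_v (transition i j) x)
    + 'D_u (fun y => 'D_v (transition i j) y) x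
}.

Section AffineCombination.
Context {R : realType} {n : nat} {M : complexManifold R n}.
Variables (a b : R) (ab1 : a + b = 1) (D D' : connection M).

Definition comb_symbols (i : chart_idx M) (x u v : Cspace R n) : Cspace R n :=
  a *: D i x u v + b *: D' i x u v.

Fact comb_bilinear i x : chart_img i x -> bilinear2 (comb_symbols i x).
Proof.
move=> ix; have [Dl Dr] := christoffel_bilinear D ix.
have [Dl' Dr'] := christoffel_bilinear D' ix.
by split=> [u k v w|v k u w]; rewrite /comb_symbols ?Dl ?Dl' ?Dr ?Dr' !scalerDr
  !scalerA ![_ * k]mulrC addrACA.
Qed.

Fact comb_smooth i u v :
  smooth_on (chart_img i) (fun x => comb_symbols i x u v).
Proof.
move=> k; have := christoffel_smooth D' i u v k.
have := christoffel_smooth D i u v k.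
by apply: Ck_lincomb => //; exact: chart_img_open.
Qed.

Fact comb_change i j x u v : overlap i j x ->
  'D_(comb_symbols i x u v) (transition i j) x =
  comb_symbols j (transition i j x) ('D_u (transition i j) x)
         ('D_v (transition i j) x)
  + 'D_u (fun y => 'D_v (transition i j) y) x.
Proof.
move=> ijx; have [dt _] := transition_holomorphic ijx.
have DE := christoffel_change D u v ijx.
have DE' := christoffel_change D' u v ijx.
rewrite [LHS]deriveE // linearD !linearZ -!deriveE //= [in LHS]DE [in LHS]DE'.
by rewrite /comb_symbols !scalerDr addrACA -scalerDl ab1 scale1r.
Qed.

Definition affine_comb : connection M :=
  Connection comb_bilinear comb_smooth comb_change.

End AffineCombination.

Section HermitianGeometry.
Context {R : realType} {n : nat} {M : complexManifold R n}.
Implicit Types (g : hermitianMetric M) (D : connection M) (i : chart_idx M).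
Local Notation E := (Cspace R n).

(* D_X Y, for vector fields X and Y on the domain of the i-th chart. *)
Definition cov D i (X Y : E -> E) (x : E) : E :=
  'D_(X x) Y x + D i x (X x) (Y x).

(* Torsion, curvature, Dg, DJ and the exterior derivative are tensorial: they
   are computed on the constant coordinate vector fields of a chart, whose Lie
   brackets vanish. *)

(* T(X, Y) = D_X Y - D_Y X - [X, Y] *)
Definition torsion D i (x u v : E) : E :=
  cov D i (cst u) (cst v) x - cov D i (cst v) (cst u) x.

(* R(X, Y) Z = D_X D_Y Z - D_Y D_X Z - D_[X, Y] Z *)
Definition curvature_op D i (x u v w : E) : E :=
  cov D i (cst u) (cov D i (cst v) (cst w)) x
  - cov D i (cst v) (cov D i (cst u) (cst w)) x.

Definition curvature g D i (x u v w z : E) : R :=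
  g i x (curvature_op D i x u v w) z.

(* Dg = 0 *)
Definition metric_connection g D : Prop :=
  forall i x u v w, chart_img i x ->
    'D_w (fun y => g i y u v) x =
    g i x (cov D i (cst w) (cst u) x) v + g i x u (cov D i (cst w) (cst v) x).

(* DJ = 0 *)
Definition complex_connection D : Prop :=
  forall i x u w, chart_img i x ->
    cov D i (cst w) (cst (Jmap u)) x = Jmap (cov D i (cst w) (cst u) x).

(* A real 2-form splits into its J-invariant part, which is the (1,1)-part,
   and its J-anti-invariant part, which is the (2,0)+(0,2)-part. *)
Definition torsion11 D i (x u v : E) : E :=
  2^-1 *: (torsion D i x u v + torsion D i x (Jmap u) (Jmap v)).

Definition levi_civita g D : Prop :=
  metric_connection g D /\
  forall i x u v, chart_img i x -> torsion D i x u v = 0.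

Definition chern g D : Prop :=
  [/\ metric_connection g D, complex_connection D &
      forall i x u v, chart_img i x -> torsion11 D i x u v = 0].

(* g(T(x, y), z) is skew in x, y by construction. *)
Definition strominger g D : Prop :=
  [/\ metric_connection g D, complex_connection D &
      forall i x u v w, chart_img i x ->
        g i x (torsion D i x u v) w = - g i x (torsion D i x u w) v].

Definition kahler_like g D : Prop :=
  forall i x u v w z, chart_img i x ->
    [/\ curvature g D i x u v w z + curvature g D i x v w u z
          + curvature g D i x w u v z = 0,
        curvature g D i x (Jmap u) (Jmap v) w z = curvature g D i x u v w z &
        curvature g D i x u v (Jmap w) (Jmap z) = curvature g D i x u v w z].

Definition fundamental_form g i (x u v : E) : R := g i x (Jmap u) v.

(* The fundamental 2-form is closed. *)
Definition kahler g : Prop :=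
  forall i x u v w, chart_img i x ->
    'D_u (fun y => fundamental_form g i y v w) x
    - 'D_v (fun y => fundamental_form g i y u w) x
    + 'D_w (fun y => fundamental_form g i y u v) x = 0.

End HermitianGeometry.

Fact gauduchon_weights (R : realType) (r : R) : (1 + r) / 2 + (1 - r) / 2 = 1.
Proof. lra. Qed.

Fact canonical_weights (R : realType) (s : R) : (1 - s) + s = 1.
Proof. by rewrite subrK. Qed.

Section CanonicalConnections.
Context {R : realType} {n : nat} {M : complexManifold R n}.
Variables (nabla nablac nablas : connection M).

Definition gauduchon (r : R) : connection M :=
  affine_comb (gauduchon_weights r) nablac nablas.

(* D^r_s, for rs = (r, s) *)
Definition canonical_connection (rs : R * R) : connection M :=
  affine_comb (canonical_weights rs.2) (gauduchon rs.1) nabla.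

End CanonicalConnections.

Definition Omega (R : realType) : set (R * R) :=
  ~` [set rs | rs.2 = 1 /\ rs.1 != 0].

(* Main.v *)
Require Import Defs.
From HB Require Import structures.
From mathcomp Require Import all_boot all_order all_algebra.
From mathcomp Require Import all_classical all_reals all_analysis.
From mathcomp Require Import complex.
From mathcomp Require Import ring lra.
Set Implicit Arguments.
Unset Strict Implicit.
Unset Printing Implicit Defensive.
Import Order.TTheory GRing.Theory Num.Theory.
Import numFieldNormedType.Exports.
Local Open Scope classical_set_scope.
Local Open Scope ring_scope.

(** The exceptional pairs are where elimination stalls. Removing the (0,1)-derivative of tau from
    the identities of one connection with s <> 0 leaves 4 (1 - a)^2 P + (s^2 + 2a - 3a^2) (w - w') =
    0, where w is a difference of two values of W and w' exchanges its last two indices; this is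
    void exactly at (1, 1) and (1, -1). At a = 0 the decisive factor is 4 - s^2, which vanishes at
    (0, 2) and (0, -2). The (1,0)-derivative of tau is (a - 2) X if a <> 0 and -a X if s <> 0, with
    X quadratic in tau. Two different multiples force X = 0; for nabla^+ or nabla^- against nabla^s
    both multiples are 0, so nothing follows. Another obstacle is that trace identities have to be
    differentiated, while unitary frames are constructed at single points only. Derivatives are
    therefore taken of real traces over the fixed coordinate basis of a chart, and only the outcome
    is rewritten in a unitary frame. *)

(* Let tau be half the torsion of the Chern connection. It is bilinear over the
   complex numbers, hence a bracket on each tangent space; let sig u be the
   Hermitian adjoint of tau u. In terms of the Chern connection D,
     D^r_s = D + a gamma + s beta, where a = 1 - r(1 - s),
     gamma u v = - tau u v + sig u v and beta u v = sig v u.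
   Thus (a, s) is (1, 1), (1, -1), (2, 0), (0, 2), (0, -2) for nabla, nabla',
   nabla^s, nabla^+, nabla^-, and (r, s) is determined by (a, s) on Omega.

   Splitting the curvature identities of a Kahler-like D^r_s into complex types
   gives: the (1,0)-derivative of tau as a multiple of a quadratic expression in
   tau, one multiple when a <> 0 and another one when s <> 0; and the
   (0,1)-derivative of tau in terms of the contractions P of tau with its
   conjugate on the upper index and W on a lower index.  Two connections then
   give either tau (tau u v) w = 0 or linear relations between P and W, and
   contracting these with tau forces tau = 0.  First-order derivatives of trace
   identities are needed in two cases only. If s <> 0, s^2 <> 4 and a = 0, tau is
   a Lie bracket and one differentiates tr (ad [u, v]) = 0; for nabla or nabla'
   together with the Chern connection one differentiates tr (ad u) = 0, which
   makes the Killing form vanish. *)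

(** * Brackets on a unitary space *)

Section BracketAlgebra.
Variables (C : numClosedFieldType) (n : nat).
Local Notation I := 'I_n.
(* [t j i k] is the component along e_j of the bracket [e_i, e_k]. *)
Variable t : I -> I -> I -> C.
Hypothesis t_anti : forall j i k, t j i k = - t j k i.

Definition brP i k j l := \sum_m t m i k * (t m j l)^*.
Definition brW a b c d := \sum_m t a m b * (t c m d)^*.
Definition brw i k j l := brW j i k l - brW j k i l.
Definition brV m := \sum_i t i m i.
(** The Hilbert-Schmidt product of ad e_k and ad e_l; [brB] is the Gram matrix of the component
    2-forms of the bracket. *)
Definition brA k l := \sum_x t x.1 x.2 k * (t x.1 x.2 l)^*.
Definition brB l k := \sum_x t l x.1 x.2 * (t k x.1 x.2)^*.
(** The matrix of ad V^*, where V^* is the vector that represents the trace form u -> tr (ad u). *)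
Definition brH l k := \sum_m t l m k * (brV m)^*.

Lemma sum_normsq_eq0 (K : finType) (f : K -> C) :
  \sum_x f x * (f x)^* = 0 -> forall x, f x = 0.
Proof.
move=> f0 x; have f_ge0 y : true -> 0 <= f y * (f y)^*.
  by move=> _; rewrite mul_conjC_ge0.
by apply/eqP; rewrite -mul_conjC_eq0; apply/eqP; exact: (psumr_eq0P f_ge0 f0).
Qed.

Lemma brA_eq0 : (forall k, brA k k = 0) -> forall j i k, t j i k = 0.
Proof. by move=> A0 j i k; exact: (sum_normsq_eq0 (A0 k) (j, i)). Qed.

Lemma brA_conj k l : (brA k l)^* = brA l k.
Proof.
by rewrite rmorph_sum; apply: eq_bigr => x _ /=; rewrite rmorphM /= conjCK mulrC.
Qed.

Lemma brB_conj k l : (brB k l)^* = brB l k.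
Proof.
by rewrite rmorph_sum; apply: eq_bigr => x _ /=; rewrite rmorphM /= conjCK mulrC.
Qed.

Lemma brA_sum k l : brA k l = \sum_j \sum_i t j i k * (t j i l)^*.
Proof. by rewrite pair_big. Qed.

Lemma brB_sum l k : brB l k = \sum_j \sum_i t l j i * (t k j i)^*.
Proof. by rewrite pair_big. Qed.

Lemma trace_brP k l : \sum_i brP i k i l = brA k l.
Proof. by rewrite exchange_big brA_sum. Qed.

Lemma trace_brw_l k l : \sum_i brw i k i l = (brH k l)^* - brA k l.
Proof.
rewrite sumrB; congr (_ - _); last by rewrite brA_sum.
rewrite exchange_big rmorph_sum; apply: eq_bigr => m _ /=.
by rewrite rmorphM /= conjCK -mulr_suml mulrC.
Qed.

Lemma trace_brw_r k l : \sum_i brw i k l i = brB l k - brH l k.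
Proof.
rewrite sumrB; congr (_ - _).
  by rewrite brB_sum exchange_big.
rewrite exchange_big; apply: eq_bigr => m _ /=.
by rewrite -mulr_sumr rmorph_sum.
Qed.

Lemma trace_relation (p q1 q2 : C) :
  (forall i k j l, p * brP i k j l + q1 * brw i k j l + q2 * brw i k l j = 0) ->
  forall k l, p * brA k l + q1 * ((brH k l)^* - brA k l)
    + q2 * (brB l k - brH l k) = 0.
Proof.
move=> Q k l; rewrite -trace_brw_l -trace_brw_r -trace_brP !mulr_sumr.
by rewrite -!big_split /= big1 // => i _; rewrite -mulr_sumr Q.
Qed.

Lemma trace_brH : \sum_k brH k k = \sum_m brV m * (brV m)^*.
Proof. by rewrite exchange_big; apply: eq_bigr => m _; rewrite -mulr_suml. Qed.

Lemma trace_brA_brB : \sum_k brB k k = \sum_k brA k k.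
Proof.
rewrite (eq_bigr _ (fun k _ => brA_sum k k)) (eq_bigr _ (fun k _ => brB_sum k k)).
rewrite [RHS]exchange_big; apply: eq_bigr => j _ /=.
by rewrite exchange_big; apply: eq_bigr.
Qed.

Definition brN := \sum_k brA k k.
Definition brVV := \sum_m brV m * (brV m)^*.

Lemma brN_ge0 : 0 <= brN.
Proof. by do 2![apply: sumr_ge0 => ? _]; rewrite mul_conjC_ge0. Qed.

Lemma brVV_ge0 : 0 <= brVV.
Proof. by apply: sumr_ge0 => ? _; rewrite mul_conjC_ge0. Qed.

Lemma brN_eq0 : brN = 0 -> forall j i k, t j i k = 0.
Proof.
move=> N0; apply: brA_eq0 => k; apply: psumr_eq0P N0 k isT => k _.
by apply: sumr_ge0 => ? _; rewrite mul_conjC_ge0.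
Qed.

(** Trace of [trace_relation] over k = l: [brA] and [brB] both have trace |t|^2, and ad V^* has
    trace |V|^2. *)
Lemma scalar_relation (p q1 q2 : C) :
  (forall i k j l, p * brP i k j l + q1 * brw i k j l + q2 * brw i k l j = 0) ->
  p * brN + (q1 - q2) * (brVV - brN) = 0.
Proof.
move=> Q; have Qk k := trace_relation Q k k.
have HE : \sum_k (brH k k)^* = brVV.
  by rewrite -rmorph_sum trace_brH rmorph_sum; apply: eq_bigr => k _;
    rewrite rmorphM /= conjCK mulrC.
have : \sum_k (p * brA k k + q1 * ((brH k k)^* - brA k k)
    + q2 * (brB k k - brH k k)) = 0 by rewrite big1.
rewrite !big_split /= -!mulr_sumr !sumrB HE trace_brH trace_brA_brB.
by rewrite -/brN -/brVV => E; rewrite -[RHS]E; ring.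
Qed.

(** The full trace is 2 |t|^2 + 2 |V|^2 = 0. With 2 in place of 4 the |t|^2 terms cancel and only V
    = 0 survives, as in [brV_eq0_2]. *)
Lemma bracket_eq0_4 :
  (forall i k j l, 4 * brP i k j l + brw i k j l - brw i k l j = 0) ->
  forall j i k, t j i k = 0.
Proof.
move=> Q; apply: brN_eq0; have E : 4 * brN + (1 - -1) * (brVV - brN) = 0.
  by apply: scalar_relation => i k j l; rewrite mul1r mulN1r.
have {}E : brN + brVV = 0.
  by apply: (@mulfI _ 2); rewrite ?pnatr_eq0 // mulr0 -[RHS]E; ring.
have /eqP := E; rewrite paddr_eq0 ?brN_ge0 ?brVV_ge0 //.
by case/andP => /eqP.
Qed.

Lemma brVV_eq0 : brVV = 0 -> forall m, brV m = 0.
Proof. exact: sum_normsq_eq0. Qed.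

Lemma brV_eq0_2 :
  (forall i k j l, 2 * brP i k j l + brw i k j l - brw i k l j = 0) ->
  forall m, brV m = 0.
Proof.
move=> Q; apply: brVV_eq0; have E : 2 * brN + (1 - -1) * (brVV - brN) = 0.
  by apply: scalar_relation => i k j l; rewrite mul1r mulN1r.
by apply: (@mulfI _ 2); rewrite ?pnatr_eq0 // mulr0 -[RHS]E; ring.
Qed.

Lemma brV_eq0_brH : (forall m, brV m = 0) -> forall l k, brH l k = 0.
Proof. by move=> V0 l k; apply: big1 => m _; rewrite V0 conjC0 mulr0. Qed.

(* The partial trace of [brw = 0] says that A is the adjoint of [ad V^*]; by
   antisymmetry it follows that [ad V^*] = 0, hence V = 0 and A = 0. *)
Lemma bracket_eq0_w : (forall i k j l, brw i k j l = 0) ->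
  forall j i k, t j i k = 0.
Proof.
move=> w0.
have AH k l : brA k l = (brH k l)^*.
  apply/eqP; rewrite eq_sym -subr_eq0; rewrite -trace_brw_l big1 // => i _.
have M0 : forall x : I * I, \sum_k t x.1 x.2 k * (brV k)^* = 0.
  apply: sum_normsq_eq0.
  transitivity (\sum_k \sum_l brA k l * ((brV k)^* * brV l)).
    under eq_bigr => x _.
      rewrite rmorph_sum mulr_suml.
      under eq_bigr => k _ do rewrite mulr_sumr.
      over.
    rewrite exchange_big; apply: eq_bigr => k _; rewrite exchange_big.
    apply: eq_bigr => l _; rewrite mulr_suml; apply: eq_bigr => x _ /=.
    by rewrite rmorphM /= conjCK; ring.
  apply: big1 => k _.
  under eq_bigr => l _.
    rewrite AH rmorph_sum mulr_suml.
    under eq_bigr => m _ do rewrite rmorphM /= conjCK.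
    over.
  (* [brV m * brV l] is symmetric in m, l while the conjugate of [t k m l] is antisymmetric. *)
  set S := LHS; suff : S = - S by move/eqP; rewrite -addr_eq0 -mulr2n mulrn_eq0 /= => /eqP.
  rewrite {1}/S exchange_big /= /S -sumrN; apply: eq_bigr => m _.
  rewrite -sumrN; apply: eq_bigr => l _.
  by rewrite t_anti rmorphN /=; ring.
apply: brA_eq0 => k; rewrite AH (brV_eq0_brH _) ?conjC0 //.
apply: brVV_eq0; rewrite /brVV.
transitivity (\sum_m \sum_i t i m i * (brV m)^*).
  by apply: eq_bigr => m _; rewrite mulr_suml.
rewrite exchange_big big1 // => i _; apply: oppr_inj; rewrite oppr0.
rewrite -[RHS](M0 (i, i)) -sumrN; apply: eq_bigr => m _ /=.
by rewrite t_anti; ring.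
Qed.

Section TwoStepNilpotent.
Hypothesis tt0 : forall k l i j, \sum_m t m k l * t j m i = 0.

(** Multiply the partial trace by [brB k l] and sum. Every product except that of [brB] with its
    transpose contains a bracket inside a bracket, so only q2 |B|^2 is left. *)
Lemma bracket_eq0_nilpotent (p q1 q2 : C) : q2 != 0 ->
  (forall i k j l, p * brP i k j l + q1 * brw i k j l + q2 * brw i k l j = 0) ->
  forall j i k, t j i k = 0.
Proof.
move=> q2n0 Q; have PT := trace_relation Q.
have AB l : \sum_k brA k l * brB k l = 0.
  rewrite (eq_bigr (fun k => \sum_x \sum_y (t x.1 x.2 k * t k y.1 y.2)
     * ((t x.1 x.2 l)^* * (t l y.1 y.2)^*))); last first.
    move=> k _; rewrite mulr_suml; apply: eq_bigr => x _.
    by rewrite mulr_sumr; apply: eq_bigr => y _; ring.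
  rewrite exchange_big big1 // => x _; rewrite exchange_big big1 // => y _ /=.
  rewrite -mulr_suml (eq_bigr (fun k => - (t k y.1 y.2 * t x.1 k x.2))).
    by rewrite sumrN tt0 oppr0 mul0r.
  by move=> k _; rewrite t_anti; ring.
have HB l : \sum_k brH l k * brB k l = 0.
  rewrite (eq_bigr (fun k => \sum_m \sum_y (t k y.1 y.2 * t l m k)
     * ((brV m)^* * (t l y.1 y.2)^*))); last first.
    move=> k _; rewrite mulr_suml; apply: eq_bigr => x _.
    by rewrite mulr_sumr; apply: eq_bigr => y _; ring.
  rewrite exchange_big big1 // => x _; rewrite exchange_big big1 // => y _ /=.
  rewrite -mulr_suml (eq_bigr (fun k => - (t k y.1 y.2 * t l k x))).
    by rewrite sumrN tt0 oppr0 mul0r.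
  by move=> k _; rewrite (t_anti l); ring.
have HcB k : \sum_l (brH k l)^* * brB k l = 0.
  transitivity (\sum_l brH k l * brB l k)^*.
    rewrite rmorph_sum; apply: eq_bigr => l _ /=.
    by rewrite rmorphM /= brB_conj.
  by rewrite HB conjC0.
have BB : \sum_x brB x.2 x.1 * (brB x.2 x.1)^* = 0.
  transitivity (\sum_l \sum_k brB l k * brB k l).
    by rewrite pair_big /=; apply: eq_bigr => x _; rewrite brB_conj mulrC.
  apply: (mulfI q2n0); rewrite mulr0 mulr_sumr.
  transitivity (\sum_l \sum_k ((q1 - p) * (brA k l * brB k l)
     + (q2 * (brH l k * brB k l)) - q1 * ((brH k l)^* * brB k l))).
    apply: eq_bigr => l _; rewrite mulr_sumr; apply: eq_bigr => k _.
    apply/eqP; rewrite -subr_eq0; apply/eqP.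
    by rewrite -[RHS](mul0r (brB k l)) -(PT k l); ring.
  rewrite (eq_bigr (fun l => - q1 * \sum_k (brH k l)^* * brB k l)).
    rewrite -mulr_sumr exchange_big big1 ?mulr0 // => k _; exact: HcB.
  move=> l _; rewrite !big_split /= sumrN -!mulr_sumr AB HB; ring.
have B0 k : brB k k = 0 by exact: (sum_normsq_eq0 BB (k, k)).
by move=> j i k; exact: (sum_normsq_eq0 (B0 j) (i, k)).
Qed.

End TwoStepNilpotent.

Section Jacobi.
Hypothesis jacobi : forall k l i j,
  \sum_m (t m k l * t j m i + t m l i * t j m k + t m i k * t j m l) = 0.

(** Leibniz rule for ad V^*: the Jacobi identity contracted with the conjugate of [brV]. *)
Lemma brH_derivation k p a :
  \sum_b brH k b * t b p a
  = \sum_b (brH b p * t k b a + brH b a * t k p b).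
Proof.
rewrite (eq_bigr (fun b => \sum_c (t k c b * t b p a) * (brV c)^*)); last first.
  by move=> b _; rewrite mulr_suml; apply: eq_bigr => c _; ring.
rewrite [RHS](eq_bigr (fun b =>
    \sum_c (t b c p * t k b a + t b c a * t k p b) * (brV c)^*)); last first.
  move=> b _; rewrite !mulr_suml -big_split.
  by apply: eq_bigr => c _ /=; ring.
rewrite exchange_big [RHS]exchange_big; apply: eq_bigr => c _ /=.
rewrite -!mulr_suml; congr (_ * _); apply/eqP; rewrite -subr_eq0 -sumrB.
rewrite -[X in X == 0]opprK -sumrN oppr_eq0; apply/eqP.
rewrite -[RHS](jacobi p a c k); apply: eq_bigr => m _.
by rewrite (t_anti k c m) (t_anti m a c) (t_anti k p m); ring.
Qed.

(** The double sum is the squared norm of the tensor [e_i, [e_k, e_l]]. *)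
Lemma sum_brA_brB : \sum_k \sum_l brA k l * brB k l = 0 ->
  forall k l i j, \sum_m t m k l * t j m i = 0.
Proof.
move=> AB k l i j.
pose f (z : (I * I) * (I * I)) :=
  \sum_k t z.1.1 z.1.2 k * t k z.2.1 z.2.2.
have /sum_normsq_eq0 f0 : \sum_z f z * (f z)^* = 0.
  transitivity (\sum_z \sum_(w : I * I) t z.1.1 z.1.2 w.1 * t w.1 z.2.1 z.2.2
      * (t z.1.1 z.1.2 w.2 * t w.2 z.2.1 z.2.2)^*).
    apply: eq_bigr => z _; rewrite /f mulr_suml -(pair_big xpredT xpredT
      (fun a b => t z.1.1 z.1.2 a * t a z.2.1 z.2.2
      * (t z.1.1 z.1.2 b * t b z.2.1 z.2.2)^*)) /=.
    by apply: eq_bigr => a _; rewrite rmorph_sum mulr_sumr.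
  rewrite exchange_big -[RHS]AB [RHS]pair_big; apply: eq_bigr => w _ /=.
  rewrite mulr_suml -(pair_big xpredT xpredT
    (fun x y => t x.1 x.2 w.1 * t w.1 y.1 y.2
      * (t x.1 x.2 w.2 * t w.2 y.1 y.2)^*)) /=.
  apply: eq_bigr => x _; rewrite mulr_sumr; apply: eq_bigr => y _ /=.
  by rewrite rmorphM /=; ring.
apply: oppr_inj; rewrite oppr0 -[RHS](f0 ((j, i), (k, l))) -sumrN.
by apply: eq_bigr => m _; rewrite /= (t_anti j); ring.
Qed.

(* The last hypothesis is the derivative of [\sum_m brV m * t m a b = 0]
   when [t] varies with derivative proportional to [brw]. *)
Lemma bracket_eq0_jacobi (c : C) : c != 0 -> c != 4 ->
  (forall i k j l, 4 * brP i k j l + c * brw i k j l - c * brw i k l j = 0) ->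
  (forall l a b, \sum_m ((brH l m - brB l m) * t m a b + brV m * brw a b l m) = 0)
  -> forall j i k, t j i k = 0.
Proof.
move=> c0 c4 Q dV.
have Q' i k j l : 4 * brP i k j l + c * brw i k j l + (- c) * brw i k l j = 0.
  by rewrite mulNr.
have PT := trace_relation Q'.
(* The differentiated identity contracted with the conjugate of [t k a b]. *)
have HB l k : \sum_m (brH l m - brB l m) * brB m k
    + \sum_b brB l b * (brH k b)^* = 0.
  have E : \sum_x (\sum_m ((brH l m - brB l m) * t m x.1 x.2
      + brV m * brw x.1 x.2 l m)) * (t k x.1 x.2)^* = 0.
    by rewrite big1 // => x _; rewrite dV mul0r.
  rewrite -[RHS]E.
  rewrite [RHS](eq_bigr (fun x : I * I =>
     (\sum_m (brH l m - brB l m) * (t m x.1 x.2 * (t k x.1 x.2)^*)) +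
     (\sum_m brV m * brw x.1 x.2 l m) * (t k x.1 x.2)^*)); last first.
    move=> x _; rewrite big_split /= mulrDl; congr (_ + _).
    by rewrite mulr_suml; apply: eq_bigr => m _; rewrite mulrA.
  rewrite big_split /=; congr (_ + _).
    rewrite exchange_big; apply: eq_bigr => m _.
    by rewrite mulr_sumr.
  (* The [brw] term and the sum of [brB] against the conjugate of [brH] both equal twice the sum of
     [g]: the former by unfolding [brw], the latter by the Leibniz rule for ad V^*. *)
  pose g p a b := t l p a * (brH b p * t k b a)^*.
  have gE : \sum_b brB l b * (brH k b)^* = 2 * \sum_p \sum_a \sum_b g p a b.
    transitivity (\sum_p \sum_a t l p a * (\sum_b brH k b * t b p a)^*).
      rewrite pair_big /=.
      under [RHS]eq_bigr => x _ do rewrite rmorph_sum mulr_sumr.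
      rewrite exchange_big; apply: eq_bigr => b _; rewrite mulr_suml.
      by apply: eq_bigr => x _ /=; rewrite rmorphM /=; ring.
    transitivity (\sum_p \sum_a (\sum_b g p a b + \sum_b g a p b)).
      apply: eq_bigr => p _; apply: eq_bigr => a _.
      rewrite brH_derivation rmorph_sum mulr_sumr -big_split.
      apply: eq_bigr => b _ /=; rewrite /g (t_anti l a p) (t_anti k p b).
      by rewrite rmorphD !rmorphM /= rmorphN; ring.
    under eq_bigr => p _ do rewrite big_split.
    rewrite big_split /= [X in _ + X]exchange_big /=.
    by rewrite mulr_natl mulr2n.
  rewrite gE.
  transitivity (\sum_a \sum_b \sum_m \sum_p
    brV m * (t l p a * (t b p m)^* - t l p b * (t a p m)^*) * (t k a b)^*); last first.
    rewrite pair_big /=; apply: eq_bigr => x _; rewrite mulr_suml.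
    apply: eq_bigr => m _; rewrite /brw /brW -sumrB mulr_sumr mulr_suml.
    by apply: eq_bigr => p _.
  transitivity (\sum_a \sum_b \sum_p (g p a b + g p b a)).
    under [RHS]eq_bigr => a _ do under eq_bigr => b _ do rewrite big_split.
    under [RHS]eq_bigr => a _ do rewrite big_split.
    rewrite big_split /= [X in _ = _ + X]exchange_big /= -mulr2n mulr_natl.
    congr (_ *+ _); rewrite exchange_big; apply: eq_bigr => a _.
    by rewrite exchange_big.
  apply: eq_bigr => a _; apply: eq_bigr => b _; rewrite exchange_big.
  apply: eq_bigr => p _; rewrite /g /brH !mulr_suml !rmorph_sum !mulr_sumr.
  rewrite -big_split; apply: eq_bigr => m _ /=.
  rewrite !rmorphM /= !conjCK (t_anti k b a) (t_anti b p m) (t_anti a p m).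
  by rewrite !rmorphN; ring.
(* The partial trace weighted by [brB k l]: the terms free of [brA] add up to the trace of [HB]. *)
have tr0 : \sum_k \sum_l (4 - c) * (brA k l * brB k l) = 0.
  transitivity (\sum_k \sum_l - c *
    ((brH k l)^* * brB k l - brB l k * brB k l + brH l k * brB k l)).
    apply: eq_bigr => k _; apply: eq_bigr => l _.
    by apply/eqP; rewrite -subr_eq0; apply/eqP;
      rewrite -[RHS](mul0r (brB k l)) -(PT k l); ring.
  under eq_bigr => k _ do rewrite -mulr_sumr.
  rewrite -mulr_sumr; apply/eqP; rewrite mulf_eq0; apply/orP; right; apply/eqP.
  transitivity (\sum_k (\sum_m (brH k m - brB k m) * brB m k
    + \sum_b brB k b * (brH k b)^*)); last by rewrite big1.
  rewrite big_split /= [in RHS]exchange_big -big_split; apply: eq_bigr => k _ /=.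
  by rewrite -big_split; apply: eq_bigr => l _ /=; ring.
apply: (bracket_eq0_nilpotent _ (q2 := - c) _ Q'); last by rewrite oppr_eq0.
apply: sum_brA_brB; apply: (@mulfI _ (4 - c)).
  by rewrite subr_eq0 eq_sym.
rewrite mulr0 -[RHS]tr0 mulr_sumr; apply: eq_bigr => k _.
by rewrite mulr_sumr.
Qed.

End Jacobi.

Section KillingForm.

Lemma sum_six (F : I -> I -> I -> I -> I -> I -> C) :
  \sum_(x : I * I * I * I) \sum_m \sum_p F x.1.1.1 x.1.1.2 x.1.2 x.2 m p
  = \sum_(y : I * I * I * I * I * I) F y.1.1.1.1.1 y.1.1.1.1.2 y.1.1.1.2 y.1.1.2
      y.1.2 y.2.
Proof. by rewrite pair_big pair_big. Qed.

(** The Hermitian product of W, ordered as in the first term of [brw], with P; the cross terms below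
    are multiples of it. *)
Let wp := \sum_(x : I * I * I * I)
  brW x.1.2 x.1.1.1 x.1.1.2 x.2 * (brP x.1.1.1 x.1.1.2 x.1.2 x.2)^*.

Lemma brW_brP_sum : wp = \sum_(y : I * I * I * I * I * I)
  let: (i, k, j, l, m, p) := y in
  t j m i * (t k m l)^* * ((t p i k)^* * t p j l).
Proof.
rewrite /wp (eq_bigr (fun x => \sum_m \sum_p
  t x.1.2 m x.1.1.1 * (t x.1.1.2 m x.2)^*
  * ((t p x.1.1.1 x.1.1.2)^* * t p x.1.2 x.2))).
  rewrite (sum_six (fun i k j l m p => t j m i * (t k m l)^* * ((t p i k)^* * t p j l))).
  by apply: eq_bigr => [[[[[[i k] j] l] m] p]] _.
move=> [[[i k] j] l] _ /=; rewrite mulr_suml; apply: eq_bigr => m _.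
rewrite rmorph_sum mulr_sumr; apply: eq_bigr => p _ /=.
by rewrite rmorphM /= conjCK.
Qed.

Lemma brW_brW_sum (a b c d : I * I * I * I -> I) :
  \sum_x brW (a x) (b x) (c x) (d x) * (brW x.1.2 x.1.1.1 x.1.1.2 x.2)^*
  = \sum_(y : I * I * I * I * I * I) let: (x, m, p) := y in
    t (a x) m (b x) * (t (c x) m (d x))^*
    * ((t x.1.2 p x.1.1.1)^* * t x.1.1.2 p x.2).
Proof.
rewrite (eq_bigr (fun x => \sum_m \sum_p t (a x) m (b x) * (t (c x) m (d x))^*
    * ((t x.1.2 p x.1.1.1)^* * t x.1.1.2 p x.2))).
  rewrite pair_big pair_big /=.
  by apply: eq_bigr => [[[x m] p]] _.
move=> [[[i k] j] l] _ /=; rewrite mulr_suml; apply: eq_bigr => m _.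
rewrite rmorph_sum mulr_sumr; apply: eq_bigr => p _ /=.
by rewrite rmorphM /= conjCK.
Qed.

(** Both sides contract two copies of t and two conjugates along the same graph: [h] matches the
    summation indices, and three antisymmetry flips give the sign. The same holds for [brW_brW3]. *)
Lemma brW_brW2 : \sum_(x : I * I * I * I)
  brW x.1.2 x.1.1.2 x.1.1.1 x.2 * (brW x.1.2 x.1.1.1 x.1.1.2 x.2)^* = - wp.
Proof.
rewrite (brW_brW_sum (fun x => x.1.2) (fun x => x.1.1.2) (fun x => x.1.1.1) snd).
rewrite brW_brP_sum -sumrN.
pose h (y : I * I * I * I * I * I) := let: (i, k, j, l, m, p) := y in
  (p, i, k, m, l, j).
rewrite [RHS](reindex_inj (h := h)); last first.
  move=> [[[[[i k] j] l] m] p] [[[[[i' k'] j'] l'] m'] p'] [*].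
  by congr (_, _, _, _, _, _).
apply: eq_bigr => [[[[[[i k] j] l] m] p]] _ /=.
by rewrite (t_anti j m k) (t_anti k p l) (t_anti i m l) rmorphN; ring.
Qed.

Lemma brW_brW3 : \sum_(x : I * I * I * I)
  brW x.2 x.1.1.1 x.1.1.2 x.1.2 * (brW x.1.2 x.1.1.1 x.1.1.2 x.2)^* = - wp.
Proof.
rewrite (brW_brW_sum snd (fun x => x.1.1.1) (fun x => x.1.1.2) (fun x => x.1.2)).
rewrite brW_brP_sum -sumrN.
pose h (y : I * I * I * I * I * I) := let: (i, k, j, l, m, p) := y in
  (m, j, l, p, i, k).
rewrite [RHS](reindex_inj (h := h)); last first.
  move=> [[[[[i k] j] l] m] p] [[[[[i' k'] j'] l'] m'] p'] [*].
  by congr (_, _, _, _, _, _).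
apply: eq_bigr => [[[[[[i k] j] l] m] p]] _ /=.
by rewrite (t_anti l m i) (t_anti k p l) (t_anti j p i) rmorphN; ring.
Qed.

(** In this ordering the two unconjugated factors share two indices, and summing over these produces
    the Killing form. *)
Lemma brW_brW4 : (forall i k, \sum_m \sum_j t m j i * t j m k = 0) ->
  \sum_(x : I * I * I * I)
  brW x.2 x.1.1.2 x.1.1.1 x.1.2 * (brW x.1.2 x.1.1.1 x.1.1.2 x.2)^* = 0.
Proof.
move=> K0.
rewrite (brW_brW_sum snd (fun x => x.1.1.2) (fun x => x.1.1.1) (fun x => x.1.2)).
pose h (y : I * I * I * I * I * I) := let: (i, j, m, p, k, l) := y in
  (i, k, j, l, m, p).
rewrite (reindex_inj (h := h)); last first.
  move=> [[[[[i k] j] l] m] p] [[[[[i' k'] j'] l'] m'] p'] [*].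
  by congr (_, _, _, _, _, _).
transitivity (\sum_(x : I * I * I * I) \sum_k \sum_l
  (t x.1.1.1 x.1.2 x.1.1.2)^* * (t x.1.1.2 x.2 x.1.1.1)^* * (t k l x.2 * t l k x.1.2)).
  rewrite [RHS](sum_six (fun i j m p k l => (t i m j)^* * (t j p i)^* *
    (t k l p * t l k m))).
  apply: eq_bigr => [[[[[[i j] m] p] k] l]] _ /=.
  by rewrite (t_anti l m k) (t_anti k p l); ring.
apply: big1 => x _; transitivity ((t x.1.1.1 x.1.2 x.1.1.2)^*
  * (t x.1.1.2 x.2 x.1.1.1)^* * \sum_k \sum_l t k l x.2 * t l k x.1.2).
  by rewrite mulr_sumr; apply: eq_bigr => k _; rewrite mulr_sumr.
by rewrite K0 mulr0.
Qed.

Lemma brW_brW1 : \sum_(x : I * I * I * I)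
  brW x.1.2 x.1.1.1 x.1.1.2 x.2 * (brW x.1.2 x.1.1.1 x.1.1.2 x.2)^*
  = \sum_m \sum_p brA m p * brA p m.
Proof.
rewrite (brW_brW_sum (fun x => x.1.2) (fun x => x.1.1.1) (fun x => x.1.1.2) snd).
pose h (y : I * I * I * I * I * I) := let: (j, i, k, l, m, p) := y in
  (i, k, j, l, m, p).
rewrite (reindex_inj (h := h)); last first.
  move=> [[[[[i k] j] l] m] p] [[[[[i' k'] j'] l'] m'] p'] [*].
  by congr (_, _, _, _, _, _).
transitivity (\sum_(x : I * I * I * I) \sum_m \sum_p
  (t x.1.1.1 x.1.1.2 m * (t x.1.1.1 x.1.1.2 p)^*)
   * (t x.1.2 x.2 p * (t x.1.2 x.2 m)^*)).
  rewrite (sum_six (fun j i k l m p => t j i m * (t j i p)^* *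
    (t k l p * (t k l m)^*))).
  apply: eq_bigr => [[[[[[j i] k] l] m] p]] _ /=.
  rewrite (t_anti j m i) (t_anti k m l) (t_anti j p i) (t_anti k p l).
  by rewrite !rmorphN; ring.
rewrite exchange_big; apply: eq_bigr => m _.
rewrite exchange_big; apply: eq_bigr => p _.
rewrite mulr_suml.
rewrite [RHS](eq_bigr (fun x : I * I => \sum_(y : I * I)
  t x.1 x.2 m * (t x.1 x.2 p)^* * (t y.1 y.2 p * (t y.1 y.2 m)^*))).
  rewrite pair_big [RHS](reindex (fun x : I * I * I * I =>
    ((x.1.1.1, x.1.1.2), (x.1.2, x.2)))) //=.
  exists (fun x : (I * I) * (I * I) => (x.1.1, x.1.2, x.2.1, x.2.2)).
    by move=> [[[]]].
  by move=> [[? ?] []].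
by move=> x _; rewrite mulr_sumr.
Qed.

Lemma brP_brP : \sum_(x : I * I * I * I)
  brP x.1.1.1 x.1.1.2 x.1.2 x.2 * (brP x.1.1.1 x.1.1.2 x.1.2 x.2)^*
  = \sum_m \sum_p brB m p * brB p m.
Proof.
transitivity (\sum_(x : I * I * I * I) \sum_m \sum_p
  (t m x.1.1.1 x.1.1.2 * (t p x.1.1.1 x.1.1.2)^*)
   * (t p x.1.2 x.2 * (t m x.1.2 x.2)^*)).
  apply: eq_bigr => [[[[i k] j] l]] _ /=; rewrite mulr_suml; apply: eq_bigr => m _.
  rewrite rmorph_sum mulr_sumr; apply: eq_bigr => p _ /=.
  by rewrite rmorphM /= conjCK; ring.
rewrite exchange_big; apply: eq_bigr => m _.
rewrite exchange_big; apply: eq_bigr => p _.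
rewrite mulr_suml.
rewrite [RHS](eq_bigr (fun x : I * I => \sum_(y : I * I)
  t m x.1 x.2 * (t p x.1 x.2)^* * (t p y.1 y.2 * (t m y.1 y.2)^*))).
  rewrite pair_big [RHS](reindex (fun x : I * I * I * I =>
    ((x.1.1.1, x.1.1.2), (x.1.2, x.2)))) //=.
  exists (fun x : (I * I) * (I * I) => (x.1.1, x.1.2, x.2.1, x.2.2)).
    by move=> [[[]]].
  by move=> [[? ?] []].
by move=> x _; rewrite mulr_sumr.
Qed.

Lemma brw_brP_l : \sum_(x : I * I * I * I)
  brw x.1.1.1 x.1.1.2 x.1.2 x.2 * (brP x.1.1.1 x.1.1.2 x.1.2 x.2)^* = 2 * wp.
Proof.
rewrite (eq_bigr _ (fun x _ => mulrBl _ _ _)) sumrB.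
rewrite mulr_natl mulr2n; congr (_ + _).
rewrite -sumrN.
pose h (x : I * I * I * I) := let: (i, k, j, l) := x in (k, i, j, l).
rewrite (reindex_inj (h := h)); last first.
  move=> [[[i k] j] l] [[[i' k'] j'] l'] [*].
  by congr (_, _, _, _).
apply: eq_bigr => [[[[i k] j] l]] _ /=.
rewrite -mulrN; congr (_ * _); rewrite -rmorphN; congr (_^*).
by rewrite /brP -sumrN; apply: eq_bigr => m _; rewrite t_anti; ring.
Qed.

Lemma brw_brP_r : \sum_(x : I * I * I * I)
  brw x.1.1.1 x.1.1.2 x.2 x.1.2 * (brP x.1.1.1 x.1.1.2 x.1.2 x.2)^* = - (2 * wp).
Proof.
rewrite -brw_brP_l -sumrN.
pose h (x : I * I * I * I) := let: (i, k, j, l) := x in (i, k, l, j).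
rewrite (reindex_inj (h := h)); last first.
  move=> [[[i k] j] l] [[[i' k'] j'] l'] [*].
  by congr (_, _, _, _).
apply: eq_bigr => [[[[i k] j] l]] _ /=.
rewrite -mulrN; congr (_ * _); rewrite -rmorphN; congr (_^*).
rewrite /brP -sumrN; apply: eq_bigr => m _.
by rewrite (t_anti m l j) rmorphN; ring.
Qed.

(* Contracting the relation with the conjugates of [brP] and of [brW] gives
   2 |B|^2 + 4 wp = 0 and |A|^2 + 4 wp = 0, while its partial trace is A = B^T. *)
Lemma bracket_eq0_killing :
  (forall i k j l, 2 * brP i k j l + brw i k j l - brw i k l j = 0) ->
  (forall i k, \sum_m \sum_j t m j i * t j m k = 0) ->
  forall j i k, t j i k = 0.
Proof.
move=> Q K0.
pose b := \sum_m \sum_p brB m p * brB p m.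
have Q1 : 2 * b + 4 * wp = 0.
  transitivity (\sum_(x : I * I * I * I)
    (2 * brP x.1.1.1 x.1.1.2 x.1.2 x.2 + brw x.1.1.1 x.1.1.2 x.1.2 x.2
     - brw x.1.1.1 x.1.1.2 x.2 x.1.2) * (brP x.1.1.1 x.1.1.2 x.1.2 x.2)^*).
    rewrite (eq_bigr _ (fun x _ => mulrBl _ _ _)) sumrB brw_brP_r.
    rewrite (eq_bigr _ (fun x _ => mulrDl _ _ _)) big_split /= brw_brP_l.
    rewrite (eq_bigr _ (fun x _ => esym (mulrA _ _ _))) -mulr_sumr brP_brP -/b.
    ring.
  by apply: big1 => x _; rewrite Q mul0r.
have bC : b^* = b.
  rewrite rmorph_sum; apply: eq_bigr => m _; rewrite rmorph_sum /=.
  by apply: eq_bigr => p _; rewrite rmorphM /= !brB_conj mulrC.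
(* The contraction with W below yields the product of P with W, which is the conjugate of [wp]; the
   first relation shows that [wp] is real. *)
have wpC : wp^* = wp.
  have -> : wp = - (2^-1 * b).
    apply: (@mulfI _ 4); first by rewrite pnatr_eq0.
    by apply/eqP; rewrite -subr_eq0 -[X in _ == X]Q1; apply/eqP; field.
  by rewrite rmorphN rmorphM /= fmorphV rmorph_nat bC.
have BA : \sum_m \sum_p brA m p * brA p m = b.
  have E k l : brA k l = brB l k.
    have V0 := brV_eq0_2 Q.
    have Q' i k' j l' : 2 * brP i k' j l' + 1 * brw i k' j l' + (-1) * brw i k' l' j = 0.
      by rewrite mul1r mulN1r.
    have := trace_relation Q' k l; rewrite !brV_eq0_brH // conjC0 => PT.
    by apply/eqP; rewrite -subr_eq0 -[X in _ == X]PT; apply/eqP; ring.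
  apply: eq_bigr => m _; apply: eq_bigr => p _.
  by rewrite !E mulrC.
have Q2 : 4 * wp + b = 0.
  transitivity (\sum_(x : I * I * I * I)
    (2 * brP x.1.1.1 x.1.1.2 x.1.2 x.2 + brw x.1.1.1 x.1.1.2 x.1.2 x.2
     - brw x.1.1.1 x.1.1.2 x.2 x.1.2) * (brW x.1.2 x.1.1.1 x.1.1.2 x.2)^*).
    rewrite (eq_bigr _ (fun x _ => mulrBl _ _ _)) sumrB.
    rewrite (eq_bigr _ (fun x _ => mulrDl _ _ _)) big_split /=.
    rewrite (eq_bigr _ (fun x _ => esym (mulrA _ _ _))) -mulr_sumr.
    rewrite (eq_bigr _ (fun x _ => mulrBl _ _ _)) sumrB brW_brW1 brW_brW2.
    rewrite (eq_bigr _ (fun x _ => mulrBl _ _ _)) sumrB brW_brW3 brW_brW4 //.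
    have -> : \sum_(x : I * I * I * I) brP x.1.1.1 x.1.1.2 x.1.2 x.2
      * (brW x.1.2 x.1.1.1 x.1.1.2 x.2)^* = wp.
      rewrite -wpC rmorph_sum; apply: eq_bigr => x _ /=.
      by rewrite rmorphM /= conjCK mulrC.
    by rewrite BA; ring.
  by apply: big1 => x _; rewrite Q mul0r.
have b0 : b = 0.
  by transitivity (2 * b + 4 * wp - (4 * wp + b)); [ring | rewrite Q1 Q2 subr0].
have A0 : forall x : I * I, brA x.1 x.2 = 0.
  apply: sum_normsq_eq0; rewrite -[RHS]b0 -BA pair_big.
  by apply: eq_bigr => x _; rewrite brA_conj.
by apply: brA_eq0 => k; exact: (A0 (k, k)).
Qed.

End KillingForm.
End BracketAlgebra.

(** * Component identities: eliminating the derivatives of the torsion *)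

Section KahlerLikeComponents.
Variables (C : numClosedFieldType) (n : nat).
Local Notation I := 'I_n.
Variable t : I -> I -> I -> C.
Hypothesis t_anti : forall j i k, t j i k = - t j k i.
(* [d j i k l] stands for the derivative of [t j i k] along conj e_l. *)
Variable d : I -> I -> I -> I -> C.
Hypothesis d_anti : forall j i k l, d j i k l = - d j k i l.
Local Notation P := (brP t).
Local Notation W := (brW t).
Local Notation w := (brw t).
Local Notation tt0 := (forall k l i j, \sum_m t m k l * t j m i = 0).

Definition brD i k j l := w i k j l - w i k l j.
Definition brS i k j l := w i k j l + w i k l j.
Definition dE i k j l := (d i j l k)^* - (d k j l i)^*.

(** Components of [dpart], the (0,1)-part of the Bianchi identity. *)
Definition kl_first (a s : C) := forall i k j l,
  (2 - 2 * a) * d j i k l - a * dE i k j l + a ^+ 2 * (2 * P i k j l + w i k j l)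
  - s ^+ 2 * w i k l j = 0.
(** Components of [ppm], every term of which carries a factor s; dividing by it requires the
    guard. *)
Definition kl_second (a s : C) := s != 0 ->
  forall i k j l, dE i k j l = 2 * P i k j l + a * brD i k j l.

Lemma brP_anti2 i k j l : P i k l j = - P i k j l.
Proof.
rewrite /P -sumrN; apply: eq_bigr => m _.
by rewrite (t_anti m l j) rmorphN; ring.
Qed.

Lemma brP_conj i k j l : (P i k j l)^* = P j l i k.
Proof.
rewrite /P rmorph_sum; apply: eq_bigr => m _ /=.
by rewrite rmorphM /= conjCK mulrC.
Qed.

Lemma brW_conj a b c e : (W a b c e)^* = W c e a b.
Proof.
rewrite /W rmorph_sum; apply: eq_bigr => m _ /=.
by rewrite rmorphM /= conjCK mulrC.
Qed.

Lemma brD_conj i k j l : (brD i k j l)^* = brD j l i k.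
Proof.
by rewrite /brD /w !(rmorphB, rmorphD, rmorphN) /= !brW_conj; ring.
Qed.

Lemma dE_anti i k j l : dE i k l j = - dE i k j l.
Proof. by rewrite /dE (d_anti i l j) (d_anti k l j) !rmorphN; ring. Qed.

Lemma dE_conj i k j l : (dE j l i k)^* = d j i k l - d l i k j.
Proof. by rewrite /dE rmorphB /= !conjCK. Qed.

Section OneConnection.
Variables (a s : C).
Hypothesis a_real : a^* = a.
Hypothesis s_real : s^* = s.
Hypothesis kld : kl_first a s.

Let rel1 i k j l : (2 - 2 * a) * (dE j l i k)^* - 2 * a * dE i k j l
  + 4 * a ^+ 2 * P i k j l + (a ^+ 2 + s ^+ 2) * brD i k j l = 0.
Proof.
have := congr2 (fun x y => x - y) (kld i k j l) (kld i k l j).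
rewrite /= [RHS]subr0 dE_conj dE_anti brP_anti2 => E.
by rewrite -[RHS]E /brD; ring.
Qed.

(** [rel1] and its conjugate with (i, k) and (j, l) exchanged have the same quadratic terms, because
    P and [brD] are Hermitian and a, s are real. Their difference is 2 times the claim, whatever a
    is. *)
Lemma dE_herm i k j l : (dE j l i k)^* = dE i k j l.
Proof.
have E1 := rel1 i k j l; have := congr1 Num.conj (rel1 j l i k).
move: (brD_conj j l i k) (brP_conj j l i k).
move: (brD j l i k) (P j l i k) (dE j l i k) (dE i k j l) E1.
move=> x y e1 e2 E1 xE yE.
rewrite conjC0 !(rmorphB, rmorphD, rmorphM, rmorphXn, rmorph_nat) /=.
rewrite conjCK a_real s_real xE yE => E2.
have := congr2 (fun x y => x - y) E1 E2; rewrite /= [RHS]subr0 => E.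
apply/eqP; rewrite -subr_eq0; apply/eqP.
apply: (@mulfI _ 2); first by rewrite pnatr_eq0.
by rewrite mulr0 -[RHS]E; ring.
Qed.

(** Together with [kl_plus]: the parts of [kl_first] antisymmetric and symmetric in j, l. The first
    involves derivatives only through [dE]. *)
Lemma kl_minus i k j l :
  (2 - 4 * a) * dE i k j l + 4 * a ^+ 2 * P i k j l
  + (a ^+ 2 + s ^+ 2) * brD i k j l = 0.
Proof. by rewrite -[RHS](rel1 i k j l) dE_herm; ring. Qed.

Lemma kl_plus i k j l :
  (2 - 2 * a) * (d j i k l + d l i k j) + (a ^+ 2 - s ^+ 2) * brS i k j l = 0.
Proof.
have := congr2 (fun x y => x + y) (kld i k j l) (kld i k l j).
rewrite /= [RHS]addr0 dE_anti brP_anti2 => E.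
by rewrite -[RHS]E /brS; ring.
Qed.

Hypothesis klb : kl_second a s.

(** Elimination of [dE] by [kl_second]. Both coefficients vanish only for a = 1 and s^2 = 1. *)
Lemma kl_quadratic : s != 0 -> forall i k j l,
  4 * (1 - a) ^+ 2 * P i k j l + (s ^+ 2 + 2 * a - 3 * a ^+ 2) * brD i k j l = 0.
Proof.
by move=> s0 i k j l; rewrite -[RHS](kl_minus i k j l) klb //; ring.
Qed.

End OneConnection.

Let n2 : 2 != 0 :> C. Proof. by rewrite pnatr_eq0. Qed.
Let n4 : 4 != 0 :> C. Proof. by rewrite pnatr_eq0. Qed.

Lemma bracket_eq0_P : (forall i k j l, P i k j l = 0) -> forall j i k, t j i k = 0.
Proof.
move=> P0; apply: brA_eq0 => k; rewrite -trace_brP big1 // => i _; exact: P0.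
Qed.

Lemma bracket_eq0_DS : (forall i k j l, brD i k j l = 0) ->
  (forall i k j l, brS i k j l = 0) -> forall j i k, t j i k = 0.
Proof.
move=> D0 S0; apply: bracket_eq0_w => // i k j l; apply: (mulfI n2).
by rewrite mulr0 -[RHS](addr0 0) -{1}(D0 i k j l) -(S0 i k j l) /brD /brS; ring.
Qed.

Lemma bracket_eq0_PD (p q : C) : tt0 -> p != 0 \/ q != 0 ->
  (forall i k j l, p * P i k j l + q * brD i k j l = 0) -> forall j i k, t j i k = 0.
Proof.
move=> tt pq Q; have [q0|q0] := eqVneq q 0.
  case: pq => [p0|]; last by rewrite q0 eqxx.
  apply: bracket_eq0_P => i k j l; apply: (mulfI p0).
  by rewrite mulr0 -[RHS](Q i k j l) q0 mul0r addr0.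
apply: (@bracket_eq0_nilpotent _ _ t t_anti tt p q (- q)) => [|i k j l].
  by rewrite oppr_eq0.
by rewrite -[RHS](Q i k j l) /brD; ring.
Qed.

Lemma kl_one_generic a s : a^* = a -> s^* = s -> kl_first a s -> kl_second a s ->
  s != 0 -> a != 1 -> tt0 -> forall j i k, t j i k = 0.
Proof.
move=> ar sr kd kb s0 a1 tt.
apply: (bracket_eq0_PD tt _ (kl_quadratic ar sr kd kb s0)); left.
by rewrite mulf_neq0 // expf_neq0 // subr_eq0 eq_sym.
Qed.

(** At a = 1 the P term of [kl_quadratic] and the derivatives in [kl_plus] drop out, leaving [brD]
    and [brS] with factors s^2 - 1 and 1 - s^2. *)
Lemma kl_one_riemannian s : s^* = s -> kl_first 1 s -> kl_second 1 s ->
  s != 0 -> s ^+ 2 != 1 -> forall j i k, t j i k = 0.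
Proof.
move=> sr kd kb s0 s1; have ar : (1 : C)^* = 1 by exact: conjC1.
apply: bracket_eq0_DS => i k j l.
  have sn : s ^+ 2 - 1 != 0 by rewrite subr_eq0.
  by apply: (mulfI sn); rewrite mulr0 -[RHS](kl_quadratic ar sr kd kb s0 i k j l); ring.
have sn : 1 - s ^+ 2 != 0 by rewrite subr_eq0 eq_sym.
by apply: (mulfI sn); rewrite mulr0 -[RHS](kl_plus kd i k j l); ring.
Qed.

Lemma kl_one_zero s : s^* = s -> kl_first 0 s -> kl_second 0 s ->
  s != 0 -> s ^+ 2 != 4 ->
  (forall k l i j,
    \sum_m (t m k l * t j m i + t m l i * t j m k + t m i k * t j m l) = 0) ->
  (forall l a b, \sum_c (t c a b * (\sum_m d m c m l)
    + d c a b l * (\sum_m t m c m)) = 0) ->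
  forall j i k, t j i k = 0.
Proof.
move=> sr kd kb s0 s4 jac dV; have s20 : s ^+ 2 != 0 by rewrite expf_neq0.
(* At a = 0 [kl_first] determines the derivative itself, so the differentiated trace identity
   becomes the last hypothesis of [bracket_eq0_jacobi], with c = s^2. *)
have dw j i k l : d j i k l = s ^+ 2 / 2 * w i k l j.
  apply: (mulfI n2); apply/eqP; rewrite -subr_eq0 -[X in _ == X](kd i k j l).
  by apply/eqP; field.
apply: (bracket_eq0_jacobi t_anti jac s20 s4) => [i k j l|l a b].
  rewrite -[RHS](kl_quadratic (conjC0 _) sr kd kb s0 i k j l) /brD; ring.
apply: (@mulfI _ (s ^+ 2 / 2)); first by rewrite mulf_neq0 // invr_eq0.
rewrite mulr0 -[RHS](dV l a b) mulr_sumr; apply: eq_bigr => m _.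
rewrite dw -/(brV t m) (eq_bigr (fun i => - (s ^+ 2 / 2 * w i m l i))).
  by rewrite sumrN -mulr_sumr trace_brw_r; ring.
by move=> i _; rewrite dw /brw; ring.
Qed.

(** The two values of [dE] differ by (a - a') [brD], so [brD] vanishes, and [kl_quadratic] then
    kills P. At most one of a, a' equals 1, so the other may be used. *)
Lemma kl_two_generic a s a' s' : a^* = a -> s^* = s -> a'^* = a' -> s'^* = s' ->
  kl_first a s -> kl_second a s -> kl_first a' s' -> kl_second a' s' ->
  s != 0 -> s' != 0 -> a != a' -> forall j i k, t j i k = 0.
Proof.
wlog a1 : a s a' s' / a != 1 => [H|].
  move=> ar sr ar' sr' kd kb kd' kb' s0 s0' aa'.
  have [a1|a1] := eqVneq a 1; last exact: (H a s a' s').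
  by apply: (H a' s' a s) => //; rewrite eq_sym // -a1.
move=> ar sr ar' sr' kd kb kd' kb' s0 s0' aa'.
have D0 i k j l : brD i k j l = 0.
  have sn : a - a' != 0 by rewrite subr_eq0.
  apply: (mulfI sn); rewrite mulr0.
  have := kb s0 i k j l; rewrite kb' // => /eqP.
  by rewrite -subr_eq0 => /eqP E; apply: oppr_inj; rewrite oppr0 -[RHS]E; ring.
apply: bracket_eq0_P => i k j l.
have c : 4 * (1 - a) ^+ 2 != 0.
  by rewrite mulf_neq0 // expf_neq0 // subr_eq0 eq_sym.
apply: (mulfI c); rewrite mulr0.
by rewrite -[RHS](kl_quadratic ar sr kd kb s0 i k j l) D0 mulr0 addr0.
Qed.

(** The connection with s <> 0 supplies [dE], which is inserted into [kl_minus] for the one with s =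
    0. The cases a = 1 and a = 0 below proceed likewise. *)
Lemma kl_riemannian_gauduchon s a : s^* = s -> a^* = a -> s != 0 ->
  kl_second 1 s -> kl_first a 0 -> a != 1 -> tt0 ->
  forall j i k, t j i k = 0.
Proof.
move=> sr ar s0 kb kd a1 tt.
apply: (@bracket_eq0_PD (4 * (1 - a) ^+ 2) (2 - 4 * a + a ^+ 2)) => //.
  by left; rewrite mulf_neq0 // expf_neq0 // subr_eq0 eq_sym.
move=> i k j l; rewrite -[RHS](kl_minus ar (conjC0 _) kd i k j l) kb //; ring.
Qed.

Lemma kl_riemannian_one s : s^* = s -> s != 0 ->
  kl_second 1 s -> kl_first 1 0 -> forall j i k, t j i k = 0.
Proof.
move=> sr s0 kb kd; apply: bracket_eq0_DS => i k j l.
  apply: oppr_inj; rewrite oppr0.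
  by rewrite -[RHS](kl_minus (conjC1 _) (conjC0 _) kd i k j l) kb //; ring.
by rewrite -[RHS](kl_plus kd i k j l); ring.
Qed.

Lemma kl_riemannian_chern s : s^* = s -> s != 0 ->
  kl_second 1 s -> kl_first 0 0 ->
  (forall i k, \sum_m \sum_j t m j i * t j m k = 0) -> forall j i k, t j i k = 0.
Proof.
move=> sr s0 kb kd; apply: (bracket_eq0_killing t_anti) => i k j l.
have E := kl_minus (conjC0 _) (conjC0 _) kd i k j l.
apply: (mulfI n2); rewrite mulr0 -[RHS]E kb // /brD; ring.
Qed.

Lemma kl_chern_trace s : s != 0 -> kl_second 1 s -> kl_first 0 0 ->
  forall m, brV t m = 0.
Proof.
move=> s0 kb kd; apply: brV_eq0_2 => // i k j l.
have E := kl_minus (conjC0 _) (conjC0 _) kd i k j l.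
apply: (mulfI n2); rewrite mulr0 -[RHS]E kb // /brD; ring.
Qed.

Lemma kl_zero_chern s : s != 0 -> kl_second 0 s -> kl_first 0 0 ->
  forall j i k, t j i k = 0.
Proof.
move=> s0 kb kd; apply: bracket_eq0_P => i k j l; apply: (mulfI n4).
rewrite mulr0 -[RHS](kl_minus (conjC0 _) (conjC0 _) kd i k j l) kb //; ring.
Qed.

(** The Chern connection gives [dE] = 0, and [kl_minus] for a becomes a^2 (4 P + [brD]) = 0. *)
Lemma kl_chern_gauduchon a : a^* = a -> a != 0 ->
  kl_first 0 0 -> kl_first a 0 -> forall j i k, t j i k = 0.
Proof.
move=> ar a0 k0 ka; apply: bracket_eq0_4 => i k j l.
have E0 : dE i k j l = 0.
  apply: (mulfI n2); rewrite mulr0.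
  by rewrite -[RHS](kl_minus (conjC0 _) (conjC0 _) k0 i k j l); ring.
apply: (@mulfI _ (a ^+ 2)); first by rewrite expf_neq0.
rewrite mulr0 -[RHS](kl_minus ar (conjC0 _) ka i k j l) E0 /brD; ring.
Qed.

(** Eliminating [dE] between the two [kl_minus] leaves 4 P + [brD] with factor 2 (a' - a) (a + a' -
    2 a a'). If the last factor vanishes, eliminating d between the two [kl_plus] gives [brS] = 0
    instead. *)
Lemma kl_two_gauduchon a a' : a^* = a -> a'^* = a' -> a != 0 -> a' != 0 ->
  a != a' -> kl_first a 0 -> kl_first a' 0 -> tt0 -> forall j i k, t j i k = 0.
Proof.
move=> ar ar' a0 a0' aa' ka ka' tt.
have da : a' - a != 0 by rewrite subr_eq0 eq_sym.
have [e|e] := eqVneq (a + a' - 2 * a * a') 0; last first.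
  apply: bracket_eq0_4 => i k j l.
  apply: (mulfI (mulf_neq0 n2 (mulf_neq0 da e))); rewrite mulr0.
  have E := kl_minus ar (conjC0 _) ka i k j l.
  have E' := kl_minus ar' (conjC0 _) ka' i k j l.
  have := congr2 (fun x y => (2 - 4 * a) * x - (2 - 4 * a') * y) E' E.
  by rewrite /= !mulr0 [RHS]subr0 => {}E; rewrite -[RHS]E /brD; ring.
apply: (@bracket_eq0_nilpotent _ _ t t_anti tt 0 1 1); first by rewrite oner_eq0.
move=> i k j l.
apply: (mulfI (mulf_neq0 n2 (mulf_neq0 da (mulf_neq0 a0 a0')))); rewrite mulr0.
have E := kl_plus ka i k j l.
have E' := kl_plus ka' i k j l.
have := congr2 (fun x y => (2 - 2 * a) * x - (2 - 2 * a') * y) E' E.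
rewrite /= !mulr0 [RHS]subr0 => {}E.
(* The factor found is a + a' - a a', which equals a a' because a + a' = 2 a a'. *)
rewrite -[RHS]E /brS -[a * a'](subrK (a + a' - a * a')).
rewrite (_ : a * a' - _ = - (a + a' - 2 * a * a')); last by ring.
by rewrite e; ring.
Qed.

End KahlerLikeComponents.

(** * Hermitian linear algebra *)

Section Bilinear.
Context {R : realType} {n : nat} {W : lmodType R}.
Variable b : Cspace R n -> Cspace R n -> W.
Hypothesis bb : bilinear2 b.

Lemma bilD1 x y z : b (x + y) z = b x z + b y z.
Proof. by have := bb.2 z 1 x y; rewrite !scale1r. Qed.
Lemma bilD2 x y z : b x (y + z) = b x y + b x z.
Proof. by have := bb.1 x 1 y z; rewrite !scale1r. Qed.
Lemma bil01 z : b 0 z = 0.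
Proof. by apply: (addrI (b 0 z)); rewrite -bilD1 !addr0. Qed.
Lemma bil02 z : b z 0 = 0.
Proof. by apply: (addrI (b z 0)); rewrite -bilD2 !addr0. Qed.
Lemma bilZ1 c x z : b (c *: x) z = c *: b x z.
Proof. by have := bb.2 z c x 0; rewrite !addr0 bil01 addr0. Qed.
Lemma bilZ2 c x z : b x (c *: z) = c *: b x z.
Proof. by have := bb.1 x c z 0; rewrite !addr0 bil02 addr0. Qed.
Lemma bilN1 x z : b (- x) z = - b x z.
Proof. by rewrite -[- x]scaleN1r bilZ1 scaleN1r. Qed.
Lemma bilN2 x z : b x (- z) = - b x z.
Proof. by rewrite -[- z]scaleN1r bilZ2 scaleN1r. Qed.
Lemma bilB1 x y z : b (x - y) z = b x z - b y z.
Proof. by rewrite bilD1 bilN1. Qed.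
Lemma bilB2 x y z : b x (y - z) = b x y - b x z.
Proof. by rewrite bilD2 bilN2. Qed.
Lemma bil_sum1 (K : finType) (f : K -> Cspace R n) z :
  b (\sum_k f k) z = \sum_k b (f k) z.
Proof. by apply: (big_morph (b ^~ z)) => [x y|]; rewrite ?bilD1 ?bil01. Qed.

End Bilinear.

Section ComplexStructure.
Context {R : realType} {n : nat}.
Local Notation E := (Cspace R n).
Implicit Types x y z : E.

Lemma JmapD x y : Jmap (x + y) = Jmap x + Jmap y.
Proof. by rewrite /Jmap !linearD /= add_row_mx. Qed.
Lemma JmapZ (c : R) x : Jmap (c *: x) = c *: Jmap x.
Proof. by rewrite /Jmap !linearZ /= scale_row_mx. Qed.
Lemma JmapN x : Jmap (- x) = - Jmap x.
Proof. by rewrite -[- x]scaleN1r JmapZ scaleN1r. Qed.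
Lemma JmapB x y : Jmap (x - y) = Jmap x - Jmap y.
Proof. by rewrite JmapD JmapN. Qed.
Lemma JmapK x : Jmap (Jmap x) = - x.
Proof. by rewrite /Jmap row_mxKl row_mxKr -opp_row_mx hsubmxK. Qed.
Lemma Jmap0 : Jmap (0 : E) = 0.
Proof. by rewrite -(scale0r (0 : E)) JmapZ !scale0r. Qed.

End ComplexStructure.

Section HermitianSpace.
Context {R : realType} {n : nat}.
Local Notation E := (Cspace R n).
Variable g : E -> E -> R.
Hypothesis gb : bilinear2 (g : E -> E -> R^o).
Hypothesis g_sym : forall x y, g x y = g y x.
Hypothesis g_pos : forall x, x != 0 -> 0 < g x x.
Hypothesis gJ : forall x y, g (Jmap x) (Jmap y) = g x y.
Implicit Types x y z : E.

Lemma gJl x y : g (Jmap x) y = - g x (Jmap y).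
Proof. by rewrite -gJ JmapK (bilN1 gb). Qed.
Lemma gxJx x : g x (Jmap x) = 0.
Proof. by have := gJl x x; rewrite g_sym; lra. Qed.
Lemma g_inj x y : (forall z, g x z = g y z) -> x = y.
Proof.
move=> xy; apply/eqP; rewrite -subr_eq0; apply/negPn/negP => /g_pos.
by rewrite (bilB1 gb) xy subrr ltxx.
Qed.

(** Complex linear in x and antilinear in y, with J acting as i. *)
Definition herm x y : R[i] := (g x y +i* g x (Jmap y))%C.

Lemma hermJl x y : herm (Jmap x) y = 'i%C * herm x y.
Proof. by rewrite /herm gJ gJl; simpc. Qed.
Lemma hermJr x y : herm x (Jmap y) = - ('i%C * herm x y).
Proof. by rewrite /herm JmapK (bilN2 gb); simpc. Qed.
Lemma herm_conj x y : (herm x y)^* = herm y x.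
Proof.
by rewrite /herm; congr Complex; rewrite /= ?(g_sym y x) // -gJl g_sym.
Qed.
Lemma hermDl x y z : herm (x + y) z = herm x z + herm y z.
Proof. by rewrite /herm !(bilD1 gb); simpc. Qed.
Lemma hermDr x y z : herm x (y + z) = herm x y + herm x z.
Proof. by rewrite /herm JmapD !(bilD2 gb); simpc. Qed.
Lemma hermNl x z : herm (- x) z = - herm x z.
Proof. by rewrite /herm !(bilN1 gb); simpc. Qed.
Lemma hermNr x z : herm x (- z) = - herm x z.
Proof. by rewrite /herm JmapN !(bilN2 gb); simpc. Qed.
Lemma hermBl x y z : herm (x - y) z = herm x z - herm y z.
Proof. by rewrite hermDl hermNl. Qed.
Lemma hermBr x y z : herm x (y - z) = herm x y - herm x z.
Proof. by rewrite hermDr hermNr. Qed.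
Lemma hermZl (c : R) x z : herm (c *: x) z = (c%:C)%C * herm x z.
Proof. by rewrite /herm !(bilZ1 gb); simpc. Qed.
Lemma hermZr (c : R) x z : herm x (c *: z) = (c%:C)%C * herm x z.
Proof. by rewrite /herm JmapZ !(bilZ2 gb); simpc. Qed.
Lemma herm0l z : herm 0 z = 0.
Proof. by rewrite /herm !(bil01 gb). Qed.
Lemma herm_suml (K : finType) (f : K -> E) z :
  herm (\sum_k f k) z = \sum_k herm (f k) z.
Proof. by apply: (big_morph (herm ^~ z)) => [x y|]; rewrite ?hermDl ?herm0l. Qed.
Lemma herm_inj x y : (forall z, herm x z = herm y z) -> x = y.
Proof. by move=> xy; apply: g_inj => z; have [] := xy z. Qed.
Lemma Re_herm x y : complex.Re (herm x y) = g x y. Proof. by []. Qed.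

Lemma g_matrix (p : nat) (f : 'I_p -> E) x :
  x *m (\matrix_(A, B) g (delta_mx 0 A) (f B)) = \row_B g x (f B).
Proof.
apply/rowP => B; rewrite !mxE.
rewrite [in RHS](row_sum_delta x) (bil_sum1 gb); apply: eq_bigr => A _.
by rewrite mxE (bilZ1 gb).
Qed.

(** Orthogonality to k vectors amounts to 2k real equations, against the e_i and J e_i, in 2n
    unknowns. *)
Lemma orthogonal_exists (k : nat) (e : 'I_k -> E) : (k < n)%N ->
  exists2 x, x != 0 & forall i, herm x (e i) = 0.
Proof.
move=> kn.
pose f (A : 'I_(k + k)) := match fintype.split A with inl i => e i | inr i => Jmap (e i) end.
pose K := \matrix_(A, B) g (delta_mx 0 A) (f B).
have : kermx K != 0.
  rewrite -mxrank_eq0 mxrank_ker subn_eq0 -ltnNge.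
  by apply: leq_ltn_trans (rank_leq_col K) _; rewrite addnn addnn ltn_double.
move=> /rowV0Pn[x /sub_kermxP xK x0]; exists x => // i.
have {}xK B : g x (f B) = 0.
  by move: xK; rewrite g_matrix => /rowP/(_ B); rewrite !mxE.
have := xK (lshift k i); have := xK (rshift k i).
rewrite /f -[lshift k i]/(unsplit (inl i)) -[rshift k i]/(unsplit (inr i)).
by rewrite !unsplitK /herm => -> ->.
Qed.

Definition unitary (k : nat) (e : 'I_k -> E) :=
  forall i j, herm (e i) (e j) = (i == j)%:R.

Lemma unitary_exists (k : nat) : (k <= n)%N -> exists e : 'I_k -> E, unitary e.
Proof.
elim: k => [|k IH] kn; first by exists (fun=> 0) => -[].
have [e eP] := IH (ltnW kn).
have [x x0 xe] := orthogonal_exists e kn.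
have gx := g_pos x0.
pose y := (Num.sqrt (g x x))^-1 *: x.
have yy : herm y y = 1.
  rewrite hermZl hermZr /herm gxJx.
  have -> : (g x x +i* 0)%C = (((Num.sqrt (g x x)) ^+ 2)%:C)%C.
    by rewrite sqr_sqrtr // ltW.
  rewrite -!rmorphM /=; congr (_%:C)%C.
  by field; rewrite sqrtr_eq0 -ltNge.
have ye i : herm y (e i) = 0 by rewrite hermZl xe mulr0.
have ey i : herm (e i) y = 0 by rewrite -herm_conj ye conjC0.
exists (fun i => if unlift ord_max i is Some j then e j else y) => i j.
case: unliftP => [i'|] ->; case: unliftP => [j'|] ->; rewrite ?ye ?ey ?yy ?eqxx //.
- by rewrite eP (inj_eq lift_inj).
- by rewrite eq_sym (negbTE (neq_lift _ _)).
- by rewrite (negbTE (neq_lift _ _)).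
Qed.

Section Frame.
Variable e : 'I_n -> E.
Hypothesis eP : unitary e.

Let f (A : 'I_(n + n)) := match fintype.split A with inl i => e i | inr i => Jmap (e i) end.
Let K := \matrix_(A, B) g (delta_mx 0 A) (f B).

Lemma frame_sum (V : zmodType) (F : E -> V) :
  \sum_A F (f A) = \sum_i (F (e i) + F (Jmap (e i))).
Proof.
rewrite big_split_ord /= -big_split /=; apply: eq_bigr => i _.
rewrite /f -[lshift n i]/(unsplit (inl i)) -[rshift n i]/(unsplit (inr i)).
by rewrite !unsplitK.
Qed.

Lemma frame_orthonormal A B : g (f A) (f B) = (A == B)%:R.
Proof.
have ge i j : g (e i) (e j) = (i == j)%:R.
  by have /(congr1 (@complex.Re R)) /= -> := eP i j; case: (i == j).
have geJ i j : g (e i) (Jmap (e j)) = 0.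
  by have /(congr1 (@complex.Im R)) /= -> := eP i j; case: (i == j).
have [a ->] : exists a, A = unsplit a by exists (fintype.split A); rewrite splitK.
have [b ->] : exists b, B = unsplit b by exists (fintype.split B); rewrite splitK.
rewrite /f !unsplitK (can_eq (@unsplitK _ _)).
case: a => i; case: b => j /=.
- by rewrite ge.
- by rewrite geJ.
- by rewrite g_sym geJ.
- by rewrite gJ ge.
Qed.

(** Orthonormality is the product in the other order; for square matrices a one-sided inverse is
    two-sided. *)
Lemma frame_inv : K *m \matrix_A f A = 1%:M.
Proof.
apply: mulmx1C; apply/row_matrixP => A.
rewrite row_mul rowK g_matrix row1; apply/rowP => B.
by rewrite !mxE frame_orthonormal eqxx eq_sym.
Qed.

Lemma frame_expand x :
  x = \sum_i (g x (e i) *: e i + g x (Jmap (e i)) *: Jmap (e i)).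
Proof.
rewrite -(frame_sum (fun y => g x y *: y)).
rewrite -[LHS]mulmx1 -frame_inv mulmxA g_matrix mulmx_sum_row.
by apply: eq_bigr => A _; rewrite mxE rowK.
Qed.

Lemma herm_expand x y : herm x y = \sum_i herm x (e i) * herm (e i) y.
Proof.
rewrite {1}(frame_expand x) herm_suml; apply: eq_bigr => i _.
by rewrite hermDl !hermZl hermJl mulrA -mulrDl; congr (_ * _); simpc.
Qed.

Lemma frame_trace (L : E -> E) : linear L ->
  \sum_A (L (delta_mx 0 A)) 0 A = \sum_i (g (L (e i)) (e i)
    + g (L (Jmap (e i))) (Jmap (e i))).
Proof.
move=> linL; rewrite -(frame_sum (fun y => g (L y) y)).
pose L' : {linear E -> E} := HB.pack L (GRing.isLinear.Build _ _ _ _ L linL).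
have LE x : L x = L' x by [].
rewrite (eq_bigr (fun A => \sum_B K A B * (L (f B)) 0 A)).
  rewrite exchange_big; apply: eq_bigr => B _ /=.
  have /rowP/(_ B) := g_matrix f (L (f B)); rewrite !mxE => <-.
  by apply: eq_bigr => A _; rewrite mulrC.
move=> A _.
have {1}-> : delta_mx 0 A = \sum_B K A B *: f B :> E.
  rewrite -[LHS]mulmx1 -frame_inv mulmxA g_matrix mulmx_sum_row.
  by apply: eq_bigr => B _; rewrite !mxE rowK.
rewrite LE linear_sum summxE; apply: eq_bigr => B _.
by rewrite linearZ mxE.
Qed.

End Frame.
End HermitianSpace.

(** * Complex types of the curvature identities *)

Section PointwiseCurvature.
Context {R : realType} {n : nat}.
Local Notation E := (Cspace R n).
Local Notation J := Jmap.
Variable g : E -> E -> R.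
Hypothesis gb : bilinear2 (g : E -> E -> R^o).
Hypothesis g_sym : forall x y, g x y = g y x.
Hypothesis g_pos : forall x, x != 0 -> 0 < g x x.
Hypothesis gJ : forall x y, g (J x) (J y) = g x y.
Local Notation h := (herm g).
Implicit Types u v w x y z : E.

Variables tau sig : E -> E -> E.
Hypothesis tau_b : bilinear2 tau.
Hypothesis tau_anti : forall u v, tau u v = - tau v u.
Hypothesis tauJ1 : forall u v, tau (J u) v = J (tau u v).
Hypothesis sig_adj : forall u v z, g (sig u v) z = g v (tau u z).

Variables nt ns : E -> E -> E -> E.
Hypothesis nt_anti : forall u v w, nt u v w = - nt u w v.
Hypothesis ntN : forall u v w, nt (- u) v w = - nt u v w.
Hypothesis ntJ2 : forall u v w, nt u (J v) w = J (nt u v w).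
Hypothesis ns_adj : forall u v w z, g (ns u v w) z = g w (nt u v z).

Lemma tauJ2 u v : tau u (J v) = J (tau u v).
Proof. by rewrite tau_anti tauJ1 -JmapN -tau_anti. Qed.
Lemma ntJ3 u v w : nt u v (J w) = J (nt u v w).
Proof. by rewrite nt_anti ntJ2 -JmapN -nt_anti. Qed.
Lemma h_sig u v z : h (sig u v) z = h v (tau u z).
Proof. by rewrite /herm !sig_adj tauJ2. Qed.
Lemma h_ns u v w z : h (ns u v w) z = h w (nt u v z).
Proof. by rewrite /herm !ns_adj ntJ3. Qed.
Lemma sigJ1 u v : sig (J u) v = - J (sig u v).
Proof.
apply: (herm_inj gb g_pos) => z.
by rewrite h_sig tauJ1 (hermNl gb) (hermJl gb gJ) (hermJr gb) h_sig.
Qed.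
Lemma sigJ2 u v : sig u (J v) = J (sig u v).
Proof.
by apply: (herm_inj gb g_pos) => z; rewrite h_sig !(hermJl gb gJ) h_sig.
Qed.

(** The parts of [nt] linear and antilinear in the direction u: the (1,0)- and (0,1)-derivatives of
    [tau]. *)
Definition ntl u v w := 2^-1 *: (nt u v w - J (nt (J u) v w)).
Definition nta u v w := 2^-1 *: (nt u v w + J (nt (J u) v w)).

Lemma nt_split u v w : nt u v w = ntl u v w + nta u v w.
Proof.
rewrite /ntl /nta -scalerDr addrACA addNr addr0 scalerDr -scalerDl.
by rewrite (_ : _ + _ = 1) ?scale1r //; lra.
Qed.
Lemma ntlJ1 u v w : ntl (J u) v w = J (ntl u v w).
Proof. by rewrite /ntl JmapK ntN JmapZ JmapB JmapK JmapN !opprK addrC. Qed.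
Lemma ntaJ1 u v w : nta (J u) v w = - J (nta u v w).
Proof.
rewrite /nta JmapK ntN JmapZ JmapD JmapK JmapN -scalerN opprD opprK addrC.
by [].
Qed.
Lemma ntlJ2 u v w : ntl u (J v) w = J (ntl u v w).
Proof. by rewrite /ntl !ntJ2 JmapZ JmapB. Qed.
Lemma ntaJ2 u v w : nta u (J v) w = J (nta u v w).
Proof. by rewrite /nta !ntJ2 JmapZ JmapD. Qed.
Lemma ntlJ3 u v w : ntl u v (J w) = J (ntl u v w).
Proof. by rewrite /ntl !ntJ3 JmapZ JmapB. Qed.
Lemma ntaJ3 u v w : nta u v (J w) = J (nta u v w).
Proof. by rewrite /nta !ntJ3 JmapZ JmapD. Qed.
Lemma ntl_anti u v w : ntl u v w = - ntl u w v.
Proof. by rewrite /ntl (nt_anti u v) (nt_anti (J u) v) JmapN -opprD scalerN. Qed.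
Lemma nta_anti u v w : nta u v w = - nta u w v.
Proof. by rewrite /nta (nt_anti u v) (nt_anti (J u) v) JmapN -opprD scalerN. Qed.

Let hJl := hermJl gb gJ.
Let hJr := hermJr gb.
Let hDl := hermDl gb.
Let hDr := hermDr gb.
Let hNl := hermNl gb.
Let hNr := hermNr gb.
Let hBl := hermBl gb.
Let hBr := hermBr gb.
Let hZl := hermZl gb.
Let hZr := hermZr gb.
Let tD1 := bilD1 tau_b.
Let tD2 := bilD2 tau_b.
Let tN1 := bilN1 tau_b.
Let tN2 := bilN2 tau_b.
Let tZ1 := bilZ1 tau_b.
Let tZ2 := bilZ2 tau_b.

Variables (a s : R).
Local Notation ca := (a%:C)%C.
Local Notation cs := (s%:C)%C.
Local Notation ii := ('i%C : R[i]).

Definition cA u v := a *: (- tau u v + sig u v) + s *: sig v u.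
Definition cnA u v w := a *: (- nt u v w + ns u v w) + s *: ns u w v.

Lemma h_cA u x z : h (cA u x) z
  = ca * (- h (tau u x) z + h x (tau u z)) + cs * h u (tau x z).
Proof. by rewrite /cA hDl !hZl hDl hNl !h_sig. Qed.

Lemma h_cnA u v w z : h (cnA u v w) z
  = ca * (- h (nt u v w) z + h w (nt u v z)) + cs * h v (nt u w z).
Proof. by rewrite /cnA hDl !hZl hDl hNl !h_ns. Qed.

(* Parts of [h (curvature - Chern curvature) z] that are complex linear (p) or
   antilinear (m) in each of the three arguments u, v, w. *)
Definition ppp z u v w :=
  - ca * (h (ntl u v w) z - h (ntl v u w) z) - 2 * ca * h (tau (tau u v) w) z
  + ca ^+ 2 * (h (tau u (tau v w)) z - h (tau v (tau u w)) z).
Definition mmp z u v w :=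
  ca * (h w (ntl u v z) - h w (ntl v u z)) + 2 * ca * h w (tau (tau u v) z)
  + ca ^+ 2 * (h w (tau v (tau u z)) - h w (tau u (tau v z))).
Definition ppm z u v w :=
  cs * (h v (nta u w z) - h u (nta v w z)) + 2 * cs * h (tau u v) (tau w z)
  + ca * cs * (- h (tau u (sig w v)) z + h (tau v (sig w u)) z
               + h u (tau (sig v w) z) - h v (tau (sig u w) z)).
Definition pmm z u v w :=
  - cs * h u (ntl v w z)
  - ca * cs * (h u (tau (tau v w) z) + h u (tau w (tau v z))).
Definition pmp z u v w :=
  ca * (h (nta v u w) z + h w (nta u v z))
  + ca ^+ 2 * (- h (tau u (sig v w)) z + h (tau u w) (tau v z))
  + cs ^+ 2 * h u (tau (sig w v) z).

(** The difference of the curvatures of D + A and D: (D_u A)_v - (D_v A)_u + A_(T(u,v)) +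
    [A_u, A_v], where the torsion T is 2 [tau]. *)
Definition curv_diff u v w := cnA u v w - cnA v u w + 2 *: cA (tau u v) w
  + cA u (cA v w) - cA v (cA u w).

Lemma h_curv_diff u v w z : h (curv_diff u v w) z =
  ppp z u v w + mmp z u v w + ppm z u v w + pmm z u v w - pmm z v u w
  + pmp z u v w - pmp z v u w.
Proof.
rewrite /curv_diff (hBl _ (cA v (cA u w))) (hDl _ (cA u (cA v w))).
rewrite (hDl _ (2 *: cA (tau u v) w)) (hBl _ (cnA v u w)) (hZl 2).
rewrite (h_cnA u v w) (h_cnA v u w) (h_cA (tau u v) w).
rewrite (h_cA u (cA v w)) (h_cA v (cA u w)) (h_cA v w) (h_cA u w).
rewrite /cA !(tD2, tZ2, tN2, tD1, tZ1, tN1) !(hDl, hDr, hZl, hZr, hNl, hNr).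
rewrite !nt_split !(hDl (ntl _ _ _)) !(hDr _ (ntl _ _ _)) /ppp /mmp /ppm /pmm /pmp.
rewrite [(2%:C)%C](_ : _ = 2); last by rewrite -[2]/(1 + 1) rmorphD.
ring.
Qed.

Let JE := (tauJ1, tauJ2, ntlJ1, ntaJ1, ntlJ2, ntaJ2, ntlJ3, ntaJ3, sigJ1, sigJ2,
  tN1, tN2, hNl, hNr, hJl, hJr).

Lemma pppJ1 z u v w : ppp z (J u) v w = ii * ppp z u v w.
Proof. by rewrite /ppp !JE; ring. Qed.
Lemma pppJ2 z u v w : ppp z u (J v) w = ii * ppp z u v w.
Proof. by rewrite /ppp !JE; ring. Qed.
Lemma pppJ3 z u v w : ppp z u v (J w) = ii * ppp z u v w.
Proof. by rewrite /ppp !JE; ring. Qed.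
Lemma mmpJ1 z u v w : mmp z (J u) v w = - (ii * mmp z u v w).
Proof. by rewrite /mmp !JE; ring. Qed.
Lemma mmpJ2 z u v w : mmp z u (J v) w = - (ii * mmp z u v w).
Proof. by rewrite /mmp !JE; ring. Qed.
Lemma ppmJ1 z u v w : ppm z (J u) v w = ii * ppm z u v w.
Proof. by rewrite /ppm !JE; ring. Qed.
Lemma ppmJ2 z u v w : ppm z u (J v) w = ii * ppm z u v w.
Proof. by rewrite /ppm !JE; ring. Qed.
Lemma ppmJ3 z u v w : ppm z u v (J w) = - (ii * ppm z u v w).
Proof. by rewrite /ppm !JE; ring. Qed.
Lemma pmmJ1 z u v w : pmm z (J u) v w = ii * pmm z u v w.
Proof. by rewrite /pmm !JE; ring. Qed.
Lemma pmmJ2 z u v w : pmm z u (J v) w = - (ii * pmm z u v w).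
Proof. by rewrite /pmm !JE; ring. Qed.
Lemma pmmJ3 z u v w : pmm z u v (J w) = - (ii * pmm z u v w).
Proof. by rewrite /pmm !JE; ring. Qed.
Lemma pmpJ1 z u v w : pmp z (J u) v w = ii * pmp z u v w.
Proof. by rewrite /pmp !JE; ring. Qed.
Lemma pmpJ2 z u v w : pmp z u (J v) w = - (ii * pmp z u v w).
Proof. by rewrite /pmp !JE; ring. Qed.
Lemma pmpJ3 z u v w : pmp z u v (J w) = ii * pmp z u v w.
Proof. by rewrite /pmp !JE; ring. Qed.

Variable Rc : E -> E -> E -> E.
Hypothesis RcN1 : forall u v w, Rc (- u) v w = - Rc u v w.
Hypothesis RcJ3 : forall u v w, Rc u v (J w) = J (Rc u v w).
Hypothesis Rc_type : forall u v w,
  Rc u v w - Rc (J u) (J v) w + J (Rc (J u) v w + Rc u (J v) w) = 0.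
Hypothesis Rc_bianchi : forall u v w,
  Rc u v w + Rc v w u + Rc w u v = 2 *: (nt u v w + nt v w u + nt w u v)
  + 4 *: (tau (tau u v) w + tau (tau v w) u + tau (tau w u) v).

Definition curv u v w := Rc u v w + curv_diff u v w.

Lemma h_curv u v w z : h (curv u v w) z = h (Rc u v w) z +
  (ppp z u v w + mmp z u v w + ppm z u v w + pmm z u v w - pmm z v u w
  + pmp z u v w - pmp z v u w).
Proof. by rewrite /curv (hDl (Rc u v w)) h_curv_diff. Qed.

Hypothesis klB : forall u v w, curv u v w + curv v w u + curv w u v = 0.
Hypothesis klJ12 : forall u v w, curv (J u) (J v) w = curv u v w.
Hypothesis klJ3 : forall u v w, curv u v (J w) = J (curv u v w).

(** Twice the J-anti-invariant part of the 2-form [Rc]. [Rc_type] removes its (0,2)-component,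
    whence the linearity in [Rc20J1]. *)
Definition Rc20 u v w := Rc u v w - Rc (J u) (J v) w.

Lemma Rc20J1 u v w : Rc20 (J u) v w = J (Rc20 u v w).
Proof.
have /(congr1 J) := Rc_type u v w.
rewrite JmapD JmapK Jmap0 => /eqP; rewrite subr_eq0 => /eqP ->.
by rewrite /Rc20 JmapK RcN1 opprK.
Qed.

Lemma Rc20J3 u v w : Rc20 u v (J w) = J (Rc20 u v w).
Proof. by rewrite /Rc20 !RcJ3 JmapB. Qed.

(** Separates a part linear in some argument from an antilinear one: the second equation is the
    first with J applied to that argument. *)
Lemma complex_split (x y : R[i]) : x + y = 0 -> ii * x - ii * y = 0 ->
  x = 0 /\ y = 0.
Proof.
move=> xy0 xy1; have ii0 : ii != 0 by rewrite -sqrf_eq0 sqr_i oppr_eq0 oner_eq0.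
have {}xy1 : x - y = 0 by apply: (mulfI ii0); rewrite mulr0 -[RHS]xy1; ring.
have x0 : x = 0.
  apply: (@mulfI _ 2); first by rewrite pnatr_eq0.
  by rewrite mulr0 -[RHS]addr0 -{1}xy0 -xy1; ring.
by split=> //; move: xy0; rewrite x0 add0r.
Qed.

Lemma i_mulI (x : R[i]) : - (ii * (ii * x)) = x.
Proof. by rewrite mulrA -expr2 sqr_i mulN1r opprK. Qed.

(** Passing from (u, v) to (Ju, Jv) changes the sign of the parts of type (2,0) and (0,2) in u, v
    and fixes the mixed ones, so invariance leaves twice the former. *)
Let parts_eq z u v w :
  (h (Rc20 u v w) z + 2 * ppp z u v w + 2 * ppm z u v w) + 2 * mmp z u v w = 0.
Proof.
have := congr1 (fun x => h x z) (klJ12 u v w).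
rewrite !h_curv.
rewrite !(pppJ1, pppJ2, mmpJ1, mmpJ2, ppmJ1, ppmJ2, pmmJ1, pmmJ2, pmpJ1, pmpJ2).
rewrite !(mulrN, opprK, i_mulI) /Rc20 (hBl (Rc u v w)).
have e (x : R[i]) : ii * (ii * x) = - x by rewrite -[x in RHS]i_mulI opprK.
rewrite !e => /eqP; rewrite -subr_eq0 => /eqP E0.
by apply: oppr_inj; rewrite oppr0 -[RHS]E0; ring.
Qed.

Lemma kl_parts z u v w : [/\ mmp z u v w = 0, ppm z u v w = 0 &
  h (Rc20 u v w) z + 2 * ppp z u v w = 0].
Proof.
have n2 : 2 != 0 :> R[i] by rewrite pnatr_eq0.
have P1 u' v' w' : mmp z u' v' w' = 0 /\
    (h (Rc20 u' v' w') z + 2 * ppp z u' v' w') + 2 * ppm z u' v' w' = 0.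
  have E1 := parts_eq z (J u') v' w'.
  have [] := @complex_split _ _ (parts_eq z u' v' w').
    rewrite -[RHS]E1 Rc20J1 hJl pppJ1 ppmJ1 mmpJ1; ring.
  by move=> x0 /eqP; rewrite mulf_eq0 (negbTE n2) => /eqP.
have [m0 E0] := P1 u v w; have [_ E1] := P1 u v (J w).
have [] := @complex_split _ _ E0.
  by rewrite -[RHS]E1 Rc20J3 hJl pppJ3 ppmJ3; ring.
move=> x0 /eqP; rewrite mulf_eq0 (negbTE n2) => /eqP p0.
by split.
Qed.

(** Linearity in w removes the parts antilinear in w, of which only [pmm] remains; replacing u by Ju
    separates its two orderings. *)
Lemma kl_pmm z u v w : pmm z u v w = 0.
Proof.
have n2 : 2 != 0 :> R[i] by rewrite pnatr_eq0.
have ii0 : ii != 0 by rewrite -sqrf_eq0 sqr_i oppr_eq0 oner_eq0.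
have P u' v' w' : pmm z u' v' w' + - pmm z v' u' w' = 0.
  have [m0 p0 _] := kl_parts z u' v' w'.
  have [m1 p1 _] := kl_parts z u' v' (J w').
  have := congr1 (fun x => h x z) (klJ3 u' v' w').
  rewrite hJl !h_curv m0 p0 m1 p1 RcJ3 hJl pppJ3 !pmpJ3 !pmmJ3.
  move=> /eqP; rewrite -subr_eq0 => /eqP E0.
  by apply: (mulfI n2); apply: (mulfI ii0); rewrite !mulr0; apply: oppr_inj;
    rewrite oppr0 -[RHS]E0; ring.
have [] // := complex_split (P u v w).
by rewrite -[RHS](P (J u) v w) pmmJ1 pmmJ2; ring.
Qed.

(** One vector represents [mmp] in the second slot of h and [- ppp] in the first, so that [kl_quad]
    also gives [kl_ppp]. *)
Definition quad u v z := a *: (ntl u v z - ntl v u z) + (2 * a) *: tau (tau u v) z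
  + (a ^+ 2) *: (tau v (tau u z) - tau u (tau v z)).

Lemma g_eq0 y : (forall x, h x y = 0) -> y = 0.
Proof.
move=> xy; apply/eqP/negPn/negP => /g_pos.
by rewrite -Re_herm xy ltxx.
Qed.

Lemma h_quad_r u v z w : h w (quad u v z) = mmp z u v w.
Proof. by rewrite /quad !hDr !hZr !hBr rmorphM rmorphXn /= /mmp rmorph_nat; ring. Qed.

Lemma h_quad_l u v z w : h (quad u v w) z = - ppp z u v w.
Proof. by rewrite /quad !hDl !hZl !hBl rmorphM rmorphXn /= /ppp rmorph_nat; ring. Qed.

Lemma kl_quad u v z : quad u v z = 0.
Proof. by apply: g_eq0 => w; rewrite h_quad_r; case: (kl_parts z u v w). Qed.

Lemma kl_ppp z u v w : ppp z u v w = 0.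
Proof. by apply: oppr_inj; rewrite -h_quad_l kl_quad (herm0l gb) oppr0. Qed.

(* The part of the Bianchi identity that is antilinear in u only. *)
Definition dpart z u v w :=
  pmp z w u v - pmp z v u w + 2 * h (nta u v w) z.
Definition bianchi20 u v w := 2 *: (ntl u v w + ntl v w u + ntl w u v)
  + 4 *: (tau (tau u v) w + tau (tau v w) u + tau (tau w u) v).

Lemma dpartJ1 z u v w : dpart z (J u) v w = - (ii * dpart z u v w).
Proof. by rewrite /dpart !pmpJ2 ntaJ1 hNl hJl; ring. Qed.
Lemma dpartJ2 z u v w : dpart z u (J v) w = ii * dpart z u v w.
Proof. by rewrite /dpart pmpJ1 pmpJ3 ntaJ2 hJl; ring. Qed.
Lemma dpartJ3 z u v w : dpart z u v (J w) = ii * dpart z u v w.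
Proof. by rewrite /dpart pmpJ1 pmpJ3 ntaJ3 hJl; ring. Qed.
Lemma bianchi20J1 u v w : bianchi20 (J u) v w = J (bianchi20 u v w).
Proof.
by rewrite /bianchi20 !(ntlJ1, ntlJ2, ntlJ3, tauJ1, tauJ2) !(JmapD, JmapZ).
Qed.

Let bianchi_eq z u v w : (h (bianchi20 u v w) z + dpart z v w u + dpart z w u v)
  + dpart z u v w = 0.
Proof.
have E1 := congr1 (fun x => h x z) (klB u v w).
have E2 := congr1 (fun x => h x z) (Rc_bianchi u v w).
move: E1 E2; rewrite (herm0l gb).
rewrite (hDl (curv u v w + _)) (hDl (curv u v w)) !h_curv.
rewrite (hDl (Rc u v w + _)) (hDl (Rc u v w)).
rewrite (hDl (2 *: _)) !hZl (hDl (nt u v w + _)) (hDl (nt u v w)).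
rewrite (hDl (tau _ _ + _)) (hDl (tau _ _)) !kl_ppp !kl_pmm.
have [-> -> _] := kl_parts z u v w.
have [-> -> _] := kl_parts z v w u.
have [-> -> _] := kl_parts z w u v.
rewrite !nt_split !(hDl (ntl _ _ _)) !rmorph_nat.
rewrite /dpart /bianchi20 (hDl (2 *: _)) (hZl 2) (hZl 4).
rewrite (hDl (ntl _ _ _ + _)) (hDl (ntl u v w)) (hDl (tau _ _ + _)).
rewrite (hDl (tau (tau u v) w)) !rmorph_nat.
move=> E1 /eqP; rewrite -subr_eq0 => /eqP E2.
have := congr2 (fun p q => p - q) E1 E2; rewrite /= [RHS]subr0 => E.
by rewrite -[RHS]E; ring.
Qed.

(** The cyclic sum contains three such parts, each antilinear in a different argument only;
    replacing u by Ju isolates one. *)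
Lemma kl_dpart z u v w : dpart z u v w = 0.
Proof.
have [] // := complex_split (bianchi_eq z u v w).
rewrite -[RHS](bianchi_eq z (J u) v w) bianchi20J1 hJl dpartJ1 dpartJ2 dpartJ3.
ring.
Qed.

Lemma kl_bianchi20 u v w : bianchi20 u v w = 0.
Proof.
apply: (herm_inj gb g_pos) => z; rewrite (herm0l gb).
by have := bianchi_eq z u v w; rewrite !kl_dpart !addr0.
Qed.

End PointwiseCurvature.

(** * The (1,0)-derivative of the torsion: Jacobi identity and nilpotency *)

Section TorsionTensor.
Context {R : realType} {n : nat}.
Local Notation E := (Cspace R n).
Local Notation J := Jmap.
Implicit Types u v w x y z : E.
Variable tau : E -> E -> E.
Hypothesis tau_b : bilinear2 tau.
Hypothesis tau_anti : forall u v, tau u v = - tau v u.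
Variable ntl : E -> E -> E -> E.
Hypothesis ntl_anti : forall u v w, ntl u v w = - ntl u w v.

Definition torX z u v := tau (tau z u) v + tau (tau v z) u.
Definition torS u v w := tau (tau u v) w + tau (tau v w) u + tau (tau w u) v.

Lemma torS_X u v w : torX u v w + torX v w u + torX w u v = 2 *: torS u v w.
Proof.
rewrite /torX /torS; apply/rowP => k; rewrite !mxE; ring.
Qed.

(** By antisymmetry the first identity involves two of the three derivatives in the Bianchi sum;
    subtraction isolates the third. *)
Lemma quad_torsion (a : R) : a != 0 ->
  (forall u v z, a *: (ntl u v z - ntl v u z) + (2 * a) *: tau (tau u v) z
    + (a ^+ 2) *: (tau v (tau u z) - tau u (tau v z)) = 0) ->
  (forall u v w, 2 *: (ntl u v w + ntl v w u + ntl w u v) + 4 *: torS u v w = 0) ->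
  forall z u v, ntl z u v = (a - 2) *: torX z u v.
Proof.
move=> a0 Hq Hb z u v; apply: (scalerI a0).
have := Hq u v z; have := Hb z u v; rewrite /torX /torS.
rewrite (ntl_anti v u z) (tau_anti v (tau u z)) (tau_anti u (tau v z)).
rewrite (tau_anti u z) (bilN1 tau_b).
move=> /rowP B /rowP Q; apply/rowP => k; move: (B k) (Q k); rewrite !mxE; nra.
Qed.

(** The cyclic sum of [torX] is 2 [torS], which turns the Bianchi identity into 4 (c + 1) [torS] =
    0. Both multiples in use, a - 2 and - a, equal -1 only at a = 1. *)
Lemma jacobi_torsion (c : R) : c != -1 ->
  (forall z u v, ntl z u v = c *: torX z u v) ->
  (forall u v w, 2 *: (ntl u v w + ntl v w u + ntl w u v) + 4 *: torS u v w = 0) ->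
  forall u v w, torS u v w = 0.
Proof.
move=> c1 X Hb u v w; have c4 : 4 * (c + 1) != 0.
  by rewrite mulf_neq0 ?pnatr_eq0 // -[1]opprK subr_eq0.
apply: (scalerI c4); rewrite scaler0 -[RHS](Hb u v w) !X -!scalerDr torS_X.
by apply/rowP => k; rewrite !mxE; ring.
Qed.

(** Two multiples force [torX] = 0, and the Jacobi sum is [torX] plus the remaining double
    bracket. *)
Lemma nilpotent_torsion (c c' : R) : c != c' ->
  (forall z u v, ntl z u v = c *: torX z u v) ->
  (forall z u v, ntl z u v = c' *: torX z u v) ->
  (forall u v w, torS u v w = 0) -> forall u v w, tau (tau u v) w = 0.
Proof.
move=> cc' X X' S0 u v w.
have cd : c - c' != 0 by rewrite subr_eq0.
have X0 : torX w u v = 0.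
  by apply: (scalerI cd); rewrite scaler0 scalerBl -X -X' subrr.
by have := S0 w u v; rewrite /torS addrAC -/(torX w u v) X0 add0r.
Qed.

End TorsionTensor.

(** * From tensors to components in a unitary frame *)

Section Components.
Context {R : realType} {n : nat}.
Local Notation E := (Cspace R n).
Local Notation J := Jmap.
Variable g : E -> E -> R.
Hypothesis gb : bilinear2 (g : E -> E -> R^o).
Hypothesis g_sym : forall x y, g x y = g y x.
Hypothesis g_pos : forall x, x != 0 -> 0 < g x x.
Hypothesis gJ : forall x y, g (J x) (J y) = g x y.
Local Notation h := (herm g).
Implicit Types u v w x y z : E.

Variables tau sig : E -> E -> E.
Hypothesis tau_b : bilinear2 tau.
Hypothesis tau_anti : forall u v, tau u v = - tau v u.
Hypothesis tauJ1 : forall u v, tau (J u) v = J (tau u v).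
Hypothesis h_sig : forall u v z, h (sig u v) z = h v (tau u z).
Variable nta : E -> E -> E -> E.
Hypothesis nta_b : forall u, bilinear2 (nta u).
Hypothesis nta_anti : forall u v w, nta u v w = - nta u w v.
Hypothesis ntaJ2 : forall u v w, nta u (J v) w = J (nta u v w).

Variable e : 'I_n -> E.
Hypothesis eP : unitary g e.

Definition torsion_comp j i k := h (tau (e i) (e k)) (e j).
Definition dtorsion_comp j i k l := h (nta (e l) (e i) (e k)) (e j).

Lemma tcomp_anti j i k : torsion_comp j i k = - torsion_comp j k i.
Proof. by rewrite /torsion_comp tau_anti (hermNl gb). Qed.
Lemma dcomp_anti j i k l : dtorsion_comp j i k l = - dtorsion_comp j k i l.
Proof. by rewrite /dtorsion_comp nta_anti (hermNl gb). Qed.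

Lemma h_lin_expand (L : E -> E) x z :
  (forall x y, L (x + y) = L x + L y) -> (forall c x, L (c *: x) = c *: L x) ->
  (forall x, L (J x) = J (L x)) ->
  h (L x) z = \sum_m h x (e m) * h (L (e m)) z.
Proof.
move=> LD LZ LJ; rewrite {1}(frame_expand gb g_sym gJ eP x).
have L0 : L 0 = 0 by have := LZ 0 0; rewrite !scale0r.
rewrite (big_morph L LD L0) (herm_suml gb); apply: eq_bigr => i _.
rewrite LD !LZ LJ (hermDl gb) !(hermZl gb) (hermJl gb gJ) mulrA -mulrDl.
by congr (_ * _); simpc.
Qed.

Lemma h_tau_expand x y z : h (tau x y) z = \sum_m h x (e m) * h (tau (e m) y) z.
Proof.
apply: (@h_lin_expand (tau ^~ y)) => [? ?|? ?|?].
- exact: bilD1.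
- exact: bilZ1.
- exact: tauJ1.
Qed.

Lemma h_nta_expand u x y z :
  h (nta u x y) z = \sum_m h x (e m) * h (nta u (e m) y) z.
Proof.
apply: (@h_lin_expand (fun x => nta u x y)) => [? ?|? ?|?].
- exact: bilD1.
- exact: bilZ1.
- exact: ntaJ2.
Qed.

Let hC := herm_conj gb g_sym gJ.

Lemma tcomp_conj j i k : h (e j) (tau (e i) (e k)) = (torsion_comp j i k)^*.
Proof. by rewrite hC. Qed.
Lemma dcomp_conj j i k l : h (e j) (nta (e l) (e i) (e k)) = (dtorsion_comp j i k l)^*.
Proof. by rewrite hC. Qed.

Lemma brP_comp i k j l : h (tau (e i) (e k)) (tau (e j) (e l)) = brP torsion_comp i k j l.
Proof.
rewrite (herm_expand gb g_sym gJ eP); apply: eq_bigr => m _.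
by rewrite tcomp_conj.
Qed.

Lemma brW_comp1 a b c f :
  h (tau (e b) (sig (e f) (e c))) (e a) = brW torsion_comp a b c f.
Proof.
rewrite tau_anti (hermNl gb) h_tau_expand -sumrN; apply: eq_bigr => m _.
rewrite h_sig tcomp_conj -/(torsion_comp a m b) (tcomp_anti c m f) rmorphN.
by ring.
Qed.

Lemma brW_comp2 a b c f :
  h (e c) (tau (sig (e b) (e a)) (e f)) = - brW torsion_comp a b c f.
Proof.
rewrite -hC h_tau_expand rmorph_sum -sumrN; apply: eq_bigr => m _ /=.
rewrite h_sig rmorphM /= hC -/(torsion_comp a b m) -/(torsion_comp c m f).
by rewrite (tcomp_anti a b m); ring.
Qed.

Lemma tcomp_eq0 : (forall j i k, torsion_comp j i k = 0) -> forall u v, tau u v = 0.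
Proof.
move=> t0 u v; apply: (herm_inj gb g_pos) => z; rewrite (herm0l gb).
rewrite h_tau_expand big1 // => i _.
rewrite tau_anti (hermNl gb) h_tau_expand big1 ?oppr0 ?mulr0 // => k _.
rewrite (herm_expand gb g_sym gJ eP (tau _ _)) big1 ?mulr0 // => j _.
by rewrite -/(torsion_comp j k i) t0 mul0r.
Qed.

Lemma comp_tau2 k l i j :
  h (tau (tau (e k) (e l)) (e i)) (e j) = \sum_m torsion_comp m k l * torsion_comp j m i.
Proof. by rewrite h_tau_expand. Qed.

Variables (a s : R).
Local Notation ca := (a%:C)%C.
Local Notation cs := (s%:C)%C.

Lemma comp_first :
  (forall z u v w,
     ca * (h (nta u w v) z + h v (nta w u z))
     + ca ^+ 2 * (- h (tau w (sig u v)) z + h (tau w v) (tau u z))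
     + cs ^+ 2 * h w (tau (sig v u) z)
     - (ca * (h (nta u v w) z + h w (nta v u z))
     + ca ^+ 2 * (- h (tau v (sig u w)) z + h (tau v w) (tau u z))
     + cs ^+ 2 * h v (tau (sig w u) z))
     + 2 * h (nta u v w) z = 0) ->
  kl_first torsion_comp dtorsion_comp ca cs.
Proof.
move=> H i k j l; rewrite -[RHS](H (e j) (e l) (e i) (e k)).
rewrite !brW_comp1 !brW_comp2 !brP_comp !dcomp_conj -!/(dtorsion_comp _ _ _ _).
rewrite /dE /brw (dcomp_anti j k i l) (dcomp_anti i l j) (dcomp_anti k l j) !rmorphN.
rewrite (brP_anti2 tcomp_anti i k j l).
rewrite (_ : brP torsion_comp k i l j = brP torsion_comp i k j l); last first.
  by apply: eq_bigr => m _; rewrite (tcomp_anti m k i) (tcomp_anti m l j) rmorphN; ring.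
ring.
Qed.

Lemma comp_second :
  (forall z u v w,
    cs * (h v (nta u w z) - h u (nta v w z)) + 2 * cs * h (tau u v) (tau w z)
  + ca * cs * (- h (tau u (sig w v)) z + h (tau v (sig w u)) z
               + h u (tau (sig v w) z) - h v (tau (sig u w) z)) = 0) ->
  kl_second torsion_comp dtorsion_comp ca cs.
Proof.
move=> H s0 i k j l; apply: (mulfI s0); apply/eqP; rewrite -subr_eq0.
apply/eqP; rewrite -[RHS](H (e l) (e k) (e i) (e j)).
rewrite !brW_comp1 !brW_comp2 !brP_comp !dcomp_conj /dE /brD /brw.
rewrite (_ : brP torsion_comp k i j l = - brP torsion_comp i k j l); last first.
  by rewrite /brP -sumrN; apply: eq_bigr => m _; rewrite (tcomp_anti m k i); ring.
ring.
Qed.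

End Components.

(** * Connections in a holomorphic chart *)

Section LocalDerivative.
Context {R : realType} {n : nat}.
Local Notation E := (Cspace R n).
Variables (V : set E) (x u : E).
Hypothesis oV : open V.
Hypothesis Vx : V x.

Lemma near_on (W : Type) (f f' : E -> W) : (forall y, V y -> f y = f' y) ->
  \forall y \near x, f y = f' y.
Proof.
move=> ff'; have := open_nbhs_nbhs (conj oV Vx : open_nbhs x V).
by apply: filterS => y; exact: ff'.
Qed.

Lemma derive_on (W : normedModType R) (f f' : E -> W) :
  (forall y, V y -> f y = f' y) -> 'D_u f x = 'D_u f' x.
Proof. by move=> ff'; apply/near_eq_derive/near_on. Qed.

Lemma is_derive_on (W : normedModType R) (f f' : E -> W) df :
  (forall y, V y -> f' y = f y) -> is_derive x u f df -> is_derive x u f' df.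
Proof.
move=> ff' [fd <-]; apply: DeriveDef.
  apply: near_eq_derivable fd; apply: near_on => y Vy.
  by rewrite ff'.
by rewrite (derive_on ff').
Qed.

Lemma is_derive_coord (F : E -> E) A : derivable F x u ->
  is_derive x u (fun y => F y 0 A) (('D_u F x) 0 A).
Proof.
move=> Fd; apply: DeriveDef; first by move/derivable_mxP : Fd.
by rewrite derive_mx // mxE.
Qed.

(** Product rule for a linear form varying with y, reduced by a coordinate expansion to the
    derivability of each [l ^~ p]. *)
Lemma is_derive_lin (l : E -> E -> R) (F : E -> E) :
  (forall y, V y -> forall c p q, l y (c *: p + q) = c * l y p + l y q) ->
  (forall p, derivable (l ^~ p) x u) -> derivable F x u ->
  is_derive x u (fun y => l y (F y))
    ('D_u (l ^~ (F x)) x + l x ('D_u F x)).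
Proof.
move=> ll ld Fd.
have lE y p : V y -> l y p = \sum_A p 0 A * l y (delta_mx 0 A).
  move=> Vy.
  have lD q q' : l y (q + q') = l y q + l y q'.
    by rewrite -[q]scale1r ll // mul1r scale1r.
  have l0 : l y 0 = 0 by apply: (addrI (l y 0)); rewrite -lD !addr0.
  rewrite {1}(row_sum_delta p) (big_morph (l y) lD l0); apply: eq_bigr => A _.
  by rewrite -[_ *: _]addr0 ll // l0 addr0.
have ldE A := derivableP (ld (delta_mx 0 A)).
have -> : 'D_u (l ^~ (F x)) x
    = \sum_A F x 0 A * 'D_u (l ^~ (delta_mx 0 A)) x.
  rewrite (@derive_on _ _ (\sum_A (F x 0 A \*: (fun y => l y (delta_mx 0 A))))).
    rewrite derive_sum => [|A]; last by apply: derivableZ.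
    by apply: eq_bigr => A _; rewrite deriveZ.
  by move=> y Vy; rewrite lE // fct_sumE; apply: eq_bigr => A _.
rewrite lE // -big_split /=.
apply: (@is_derive_on _ (\sum_A ((fun y => F y 0 A) * (fun y => l y (delta_mx 0 A))))).
  by move=> y Vy; rewrite lE // fct_sumE; apply: eq_bigr => A _.
apply: is_derive_sum => A.
apply: is_derive_eq; first exact: (is_deriveM (is_derive_coord A Fd) (ldE A)).
by rewrite /= /GRing.scale /= [X in _ + X]mulrC.
Qed.

Lemma is_derive_Jmap (F : E -> E) : derivable F x u ->
  is_derive x u (fun y => Jmap (F y)) (Jmap ('D_u F x)).
Proof.
move=> Fd.
have JE A : is_derive x u (fun y => (Jmap (F y)) 0 A) ((Jmap ('D_u F x)) 0 A).
  apply: is_derive_eq; first apply: (@is_derive_lin (fun _ p => (Jmap p) 0 A)) => //.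
    by move=> y Vy c p q; rewrite JmapD JmapZ !mxE.
  by rewrite derive_cst add0r.
have JFd : derivable (fun y => Jmap (F y)) x u.
  by apply/derivable_mxP => i A; rewrite ord1; case: (JE A).
apply: DeriveDef => //; rewrite derive_mx //; apply/rowP => A.
by rewrite mxE; case: (JE A).
Qed.

End LocalDerivative.

(** * Pointwise algebra of Christoffel symbols and their first derivatives *)

Section ConnectionAlgebra.
Context {R : realType} {n : nat}.
Local Notation E := (Cspace R n).
Local Notation J := Jmap.
Implicit Types u v w x y z : E.
Variables G tau sig : E -> E -> E.
Hypothesis G_b : bilinear2 G.
Hypothesis sig_b : bilinear2 sig.
Hypothesis GJ1 : forall u v, G (J u) v = J (G u v).
Hypothesis GJ2 : forall u v, G u (J v) = J (G u v).
Hypothesis tauE : forall u v, tau u v = 2^-1 *: (G u v - G v u).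
Variables dG dtau dsig : E -> E -> E -> E.
Hypothesis dGN : forall u v w, dG (- u) v w = - dG u v w.
Hypothesis dGJ2 : forall u v w, dG u (J v) w = J (dG u v w).
Hypothesis dGJ3 : forall u v w, dG u v (J w) = J (dG u v w).
Hypothesis dG_b : forall u, bilinear2 (dG u).
Hypothesis dtauE : forall u v w, dtau u v w = 2^-1 *: (dG u v w - dG u w v).

Definition cov_tau u v w : E := dtau u v w + G u (tau v w) - tau (G u v) w - tau v (G u w).
Definition cov_sig u v w : E := dsig u v w + G u (sig v w) - sig (G u v) w - sig v (G u w).
Definition curv_of u v w : E := dG u v w - dG v u w + G u (G v w) - G v (G u w).

Lemma tau_bil : bilinear2 tau.
Proof.
by split=> [x c y z|z c x y]; rewrite !tauE ?(bilD1 G_b, bilD2 G_b, bilZ1 G_b, bilZ2 G_b);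
  apply/rowP => k; rewrite !mxE; ring.
Qed.

Lemma tau_skew u v : tau u v = - tau v u.
Proof. by rewrite !tauE -scalerN opprB. Qed.

Lemma tau_J u v : tau (J u) v = J (tau u v).
Proof. by rewrite !tauE GJ1 GJ2 -JmapB JmapZ. Qed.

Lemma cov_tau_skew u v w : cov_tau u v w = - cov_tau u w v.
Proof.
rewrite /cov_tau (tau_skew v (G u w)) (tau_skew (G u v)) (tau_skew v w).
rewrite (bilN2 G_b) !dtauE; apply/rowP => k; rewrite !mxE; ring.
Qed.

Lemma cov_tauN u v w : cov_tau (- u) v w = - cov_tau u v w.
Proof.
rewrite /cov_tau !dtauE !dGN !(bilN1 G_b) !(bilN1 tau_bil, bilN2 tau_bil).
by apply/rowP => k; rewrite !mxE; ring.
Qed.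

Lemma cov_tauJ u v w : cov_tau u (J v) w = J (cov_tau u v w).
Proof.
by rewrite /cov_tau !dtauE dGJ2 dGJ3 !GJ2 !tau_J !GJ2 -JmapB -JmapZ -!JmapN -!JmapD.
Qed.

Lemma cov_tau_bil u : bilinear2 (cov_tau u).
Proof.
by split=> [x c y z|z c x y]; rewrite /cov_tau !dtauE
  !(bilD1 G_b, bilD2 G_b, bilZ1 G_b, bilZ2 G_b, bilD1 tau_bil, bilD2 tau_bil,
   bilZ1 tau_bil, bilZ2 tau_bil, bilD1 (dG_b _), bilD2 (dG_b _),
   bilZ1 (dG_b _), bilZ2 (dG_b _));
  apply/rowP => k; rewrite !mxE; ring.
Qed.

Lemma curv_of_type u v w :
  curv_of u v w - curv_of (J u) (J v) w + J (curv_of (J u) v w + curv_of u (J v) w) = 0.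
Proof.
rewrite /curv_of !dGJ2 !(GJ1, GJ2) !(JmapD, JmapN, JmapK).
by apply/rowP => k; rewrite !mxE; ring.
Qed.

Lemma curv_ofJ u v w : curv_of u v (J w) = J (curv_of u v w).
Proof. by rewrite /curv_of !dGJ3 !GJ2 -!JmapN -!JmapD. Qed.

Lemma curv_ofN1 u v w : curv_of (- u) v w = - curv_of u v w.
Proof.
rewrite /curv_of dGN !(bilN1 G_b) (bilN2 G_b) (bilN1 (dG_b _)).
by apply/rowP => k; rewrite !mxE; ring.
Qed.

(** First Bianchi identity with torsion T = 2 [tau]: the sum of (D_u T)(v, w) and T(T(u, v), w)
    accounts for the factors 2 and 4. *)
Lemma curv_of_bianchi u v w :
  curv_of u v w + curv_of v w u + curv_of w u v
  = 2 *: (cov_tau u v w + cov_tau v w u + cov_tau w u v)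
  + 4 *: (tau (tau u v) w + tau (tau v w) u + tau (tau w u) v).
Proof.
have tD1 := bilB1 tau_bil; have tZ1 := bilZ1 tau_bil.
rewrite /cov_tau /curv_of !dtauE.
rewrite (tau_skew v (G u w)) (tau_skew w (G v u)) (tau_skew u (G w v)).
rewrite (tauE u v) (tauE v w) (tauE w u) !(bilZ2 G_b) !(bilB2 G_b) !tZ1 !tD1.
by by apply/rowP => k; rewrite !mxE; field.
Qed.

Variables (a s : R).
Local Notation A := (cA tau sig a s).

Lemma cA_bil : bilinear2 A.
Proof.
by split=> [x c y z|z c x y]; rewrite /cA
  !(bilD1 sig_b, bilD2 sig_b, bilZ1 sig_b, bilZ2 sig_b, bilD1 tau_bil, bilD2 tau_bil,
   bilZ1 tau_bil, bilZ2 tau_bil);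
  apply/rowP => k; rewrite !mxE; ring.
Qed.

Definition dA u v w : E := a *: (- dtau u v w + dsig u v w) + s *: dsig u w v.

(** The cross terms of G and A complete [dA] to covariant derivatives of A, up to A applied to the
    torsion. *)
Lemma curv_of_add u v w :
  (dG u v w + dA u v w) - (dG v u w + dA v u w)
   + (G u (G v w + A v w) + A u (G v w + A v w))
   - (G v (G u w + A u w) + A v (G u w + A u w))
  = curv tau sig cov_tau cov_sig a s curv_of u v w.
Proof.
rewrite /curv /curv_diff /cnA /cov_tau /cov_sig /curv_of /dA.
rewrite !(bilD2 cA_bil) !(bilD2 G_b).
move: (A u (A v w)) (A v (A u w)) => p q.
rewrite /cA ?(bilD2 G_b, bilZ2 G_b, bilN2 G_b).
rewrite (tauE u v).
rewrite !(bilZ1 sig_b, bilB1 sig_b, bilZ2 sig_b, bilB2 sig_b).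
rewrite (bilZ1 tau_bil) (bilB1 tau_bil).
by apply/rowP => k; rewrite !mxE; field.
Qed.

End ConnectionAlgebra.

(** Moving J from the first slot to the second costs a sign directly, but none by way of the third
    slot. *)
Lemma skew_J_form_eq0 (R : realType) (n : nat)
    (b : Cspace R n -> Cspace R n -> Cspace R n -> R) :
  (forall u v w, b u v w = - b u w v) -> (forall u v w, b u v w = - b w v u) ->
  (forall u v w, b u (Jmap v) (Jmap w) = b u v w) ->
  (forall u v w, b u v (- w) = - b u v w) -> forall u v w, b u v w = 0.
Proof.
move=> s23 s13 bJ bN.
have J2 u v w : b u v (Jmap w) = - b u (Jmap v) w.
  by rewrite -(bJ u v (Jmap w)) JmapK bN.
have J0 u v w : b u (Jmap v) w = 0.
  have : b (Jmap u) v w = - b u (Jmap v) w by rewrite s13 J2 opprK s13.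
  have : b (Jmap u) v w = b u (Jmap v) w.
    by rewrite s23 s13 J2 opprK -s13 s23 J2 !opprK.
  by move=> ->; lra.
by move=> u v w; have := J0 u (Jmap v) w; rewrite JmapK s23 bN opprK s23; lra.
Qed.

Lemma derive_lincomb (R : realType) (E W : normedModType R) (f0 f1 f2 f3 : E -> W)
    (a s : R) x u : derivable f0 x u -> derivable f1 x u -> derivable f2 x u ->
  derivable f3 x u ->
  'D_u (fun y => f0 y + (a *: (- f1 y + f2 y) + s *: f3 y)) x
  = 'D_u f0 x + (a *: (- 'D_u f1 x + 'D_u f2 x) + s *: 'D_u f3 x).
Proof.
move=> d0 d1 d2 d3.
have d12 : derivable (- f1 + f2) x u by apply: derivableD => //; exact: derivableN.
have da : derivable (a \*: (- f1 + f2)) x u by exact: derivableZ.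
have ds : derivable (s \*: f3) x u by exact: derivableZ.
have -> : (fun y => f0 y + (a *: (- f1 y + f2 y) + s *: f3 y))
  = f0 + (a \*: (- f1 + f2) + s \*: f3) by [].
rewrite (deriveD d0 (derivableD da ds)) (deriveD da ds) (deriveZ _ d12).
by rewrite (deriveZ _ d3) (deriveD (derivableN d1) d2) (deriveN d1).
Qed.

(** * The canonical connections in terms of the Chern torsion *)

Section HermitianTorsion.
Context {R : realType} {n : nat} {M : complexManifold R n}.
Local Notation E := (Cspace R n).
Local Notation J := Jmap.
Variables (g : hermitianMetric M) (nabla nablac nablas : connection M).
Hypothesis nablaP : levi_civita g nabla.
Hypothesis nablacP : chern g nablac.
Hypothesis nablasP : strominger g nablas.
Variable i : chart_idx M.
Local Notation V := (@chart_img _ _ M i).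
Implicit Types u v w z : E.

Lemma cov_cst (D : connection M) x u v : cov D i (cst u) (cst v) x = D i x u v.
Proof. by rewrite /cov derive_cst add0r. Qed.

Lemma g_bil y : V y -> bilinear2 (metric g i y : E -> E -> R^o).
Proof. exact: metric_bilinear. Qed.

Lemma connection_derivable (D : connection M) x u v w : V x ->
  derivable (fun y => D i y v w) x u.
Proof.
by move=> Vx; apply: diff_derivable; case: (christoffel_smooth D i v w 1) => + _; exact.
Qed.

Lemma metric_derivable x u v w : V x -> derivable (fun y => g i y v w) x u.
Proof.
by move=> Vx; apply: diff_derivable; case: (metric_smooth g i v w 1) => + _; exact.
Qed.

Definition chern_tau y u v : E := 2^-1 *: (nablac i y u v - nablac i y v u).
(* By [sig_adj], the Hermitian adjoint of [tau y u]; as a combination of the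
   given connections it is visibly smooth in y. *)
Definition chern_sig y u v : E :=
  2^-1 *: (nablas i y u v - nablac i y u v) + chern_tau y u v.
Local Notation tau := chern_tau.
Local Notation sig := chern_sig.

Section AtPoint.
Variable y : E.
Hypothesis Vy : V y.
Local Notation G := (nablac i y).

Lemma chern_J2 u v : G u (J v) = J (G u v).
Proof. by have [_ H _] := nablacP; have := H i y v u Vy; rewrite !cov_cst. Qed.

Lemma strominger_J2 u v : nablas i y u (J v) = J (nablas i y u v).
Proof. by have [_ H _] := nablasP; have := H i y v u Vy; rewrite !cov_cst. Qed.

(** The defect [b] is linear in v', antilinear in u', and symmetric because the (1,1)-torsion
    vanishes; hence J b = - J b. *)
Lemma chern_J1 u v : G (J u) v = J (G u v).
Proof.
have [_ _ H] := nablacP; have Gb := christoffel_bilinear nablac Vy.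
have {}H u' v' : G u' v' - G v' u' + J (G (J u') v' - G (J v') u') = 0.
  have := H i y u' v' Vy; rewrite /torsion11 /torsion !cov_cst !chern_J2.
  move=> /eqP; rewrite scaler_eq0 invr_eq0 pnatr_eq0 /= => /eqP.
  by rewrite JmapB.
pose b u' v' := G (J u') v' - J (G u' v').
have b_sym u' v' : b u' v' = b v' u'.
  have /(congr1 J) := H u' v'; rewrite Jmap0 JmapD JmapK !JmapB => /eqP.
  rewrite subr_eq0 /b => /eqP.
  move: (J (G u' v')) (J (G v' u')) (G (J u') v') (G (J v') u') => p q r t.
  by move/rowP => E; apply/rowP => k; move: (E k); rewrite !mxE; lra.
have b2 u' v' : b u' (J v') = J (b u' v').
  by rewrite /b !chern_J2 JmapB.
have b1 u' v' : b (J u') v' = - J (b u' v').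
  by rewrite /b JmapK (bilN1 Gb) JmapB JmapK opprK opprD addrC.
have Jb u' v' : J (b u' v') = 0.
  have : J (b u' v') = - J (b u' v') by rewrite -b1 b_sym -b2 b_sym.
  move/eqP; rewrite -addr_eq0 -mulr2n -scaler_nat scaler_eq0 pnatr_eq0 /=.
  by move/eqP.
have b0 : b u v = 0.
  by apply: oppr_inj; rewrite -JmapK Jb Jmap0 oppr0.
by move/eqP: b0; rewrite subr_eq0 => /eqP.
Qed.

Let gb := g_bil Vy.
Let gs u v : g i y u v = g i y v u := Defs.metric_sym g u v Vy.
Let gJy u v : g i y (J u) (J v) = g i y u v := metric_J g u v Vy.

Lemma metric_compat (D : connection M) u v w : metric_connection g D ->
  'D_w (fun y => g i y u v) y = g i y (D i y w u) v + g i y u (D i y w v).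
Proof. by move=> H; rewrite H // !cov_cst. Qed.

Lemma sig_adj u v w : g i y (sig y u v) w = g i y v (tau y u w).
Proof.
pose B u v w := g i y (nablas i y u v) w.
pose C u v w := g i y (nablac i y u v) w.
have tE u' v' w' : g i y (tau y u' v') w' = (C u' v' w' - C v' u' w') / 2.
  by rewrite /chern_tau (bilZ1 gb) (bilB1 gb) /C mulrC.
have [Bm BJ BT] := nablasP; have [Cm _ _] := nablacP.
have BC u' v' w' : B u' v' w' + B u' w' v' = C u' v' w' + C u' w' v'.
  rewrite /B /C (gs (nablas i y u' w')) (gs (nablac i y u' w')).
  by rewrite -(metric_compat v' w' u' Bm) -(metric_compat v' w' u' Cm).
have BS u' v' w' : B u' v' w' - B v' u' w' = - (B u' w' v' - B w' u' v').
  have := BT i y u' v' w' Vy; rewrite /torsion !cov_cst !(bilB1 gb) => ->.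
  by [].
pose e u v w := (B u v w - C u v w) / 2 + (C u v w - C v u w) / 2
  - (C u w v - C w u v) / 2.
have CJ u' v' w' : C u' (J v') (J w') = C u' v' w' by rewrite /C chern_J2 gJy.
have CJ1 u' v' w' : C (J v') u' (J w') = C v' u' w' by rewrite /C chern_J1 gJy.
have BJ' u' v' w' : B u' (J v') (J w') = B u' v' w' by rewrite /B strominger_J2 gJy.
have s23 u' v' w' : e u' v' w' = - e u' w' v'.
  by rewrite /e; have := BC u' v' w'; lra.
have s13 u' v' w' : e u' v' w' = - e w' v' u'.
  rewrite /e; have := BS v' u' w'; have := BC v' u' w'.
  by have := BC w' v' u'; have := BC u' v' w'; lra.
have eJ u' v' w' : e u' (J v') (J w') = e u' v' w'.
  by rewrite /e BJ' !CJ !CJ1.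
have Sb := christoffel_bilinear nablas Vy.
have Gb := christoffel_bilinear nablac Vy.
have eN u' v' w' : e u' v' (- w') = - e u' v' w'.
  rewrite /e /B /C !(bilN2 gb) !(bilN1 Gb) !(bilN2 Gb) !(bilN1 gb).
  lra.
have := skew_J_form_eq0 s23 s13 eJ eN u v w.
rewrite /chern_sig (bilD1 gb) (bilZ1 gb) (bilB1 gb) tE (gs v) tE /e.
by rewrite -!/(B _ _ _) -!/(C _ _ _) -[_ *: _]/(_ * _); lra.
Qed.

(** A Koszul computation from metric compatibility of both connections and the symmetry of
    [nabla]. *)
Lemma levi_civitaE u v : nabla i y u v
  = nablac i y u v + cA (tau y) (sig y) 1 1 u v.
Proof.
apply: (g_inj gb) => [x x0|w]; first exact: metric_pos.
have [Lm LT] := nablaP; have [Cm _ _] := nablacP.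
have Ls u' v' : nabla i y u' v' = nabla i y v' u'.
  apply/eqP; rewrite -subr_eq0; have := LT i y u' v' Vy.
  by rewrite /torsion !cov_cst => ->.
pose L u v w := g i y (nabla i y u v) w.
pose C u v w := g i y (nablac i y u v) w.
have LC u' v' w' : L u' v' w' + L u' w' v' = C u' v' w' + C u' w' v'.
  rewrite /L /C (gs (nabla i y u' w')) (gs (nablac i y u' w')).
  by rewrite -(metric_compat v' w' u' Lm) -(metric_compat v' w' u' Cm).
have tE u' v' w' : g i y (tau y u' v') w' = (C u' v' w' - C v' u' w') / 2.
  by rewrite /chern_tau (bilZ1 gb) (bilB1 gb) /C mulrC.
have LL u' v' w' : L u' v' w' = L v' u' w' by rewrite /L Ls.
rewrite /cA !scale1r (bilD1 gb (nablac i y u v)) (bilD1 gb (- tau y u v + sig y u v)).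
rewrite (bilD1 gb (- tau y u v)) (bilN1 gb) !sig_adj (gs v) (gs u) !tE.
rewrite -/(L _ _ _) -/(C _ _ _).
have := LC u v w; have := LC v u w; have := LC w u v.
by have := LL u v w; have := LL u w v; have := LL v w u; lra.
Qed.

Lemma stromingerE u v : nablas i y u v
  = nablac i y u v + cA (tau y) (sig y) 2 0 u v.
Proof.
rewrite /cA /chern_sig scale0r addr0 addrCA addNr addr0 scalerA.
by rewrite (_ : 2 * 2^-1 = 1) ?scale1r ?subrKC //; lra.
Qed.

(** The coefficient of gamma is (1 - s) (1 - r) + s: the Strominger term contributes 2 gamma with
    weight (1 - s) (1 - r) / 2. *)
Lemma canonicalE (p : R * R) u v :
  canonical_connection nabla nablac nablas p i y u v
  = nablac i y u v + cA (tau y) (sig y) (1 - p.1 * (1 - p.2)) p.2 u v.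
Proof.
rewrite /= /comb_symbols /= /comb_symbols levi_civitaE stromingerE /cA.
by apply/rowP => k; rewrite !mxE; field.
Qed.

End AtPoint.
Section DerivativeAtPoint.
Variable x : E.
Hypothesis Vx : V x.
Let oV : open V := @chart_img_open _ _ M i.

Definition dchern u v w : E := 'D_u (fun y => nablac i y v w) x.
Definition dchern_tau u v w : E := 'D_u (fun y => tau y v w) x.
Definition dchern_sig u v w : E := 'D_u (fun y => sig y v w) x.
Local Notation dtau := dchern_tau.
Local Notation dsig := dchern_sig.

Lemma dchernN u v w : dchern (- u) v w = - dchern u v w.
Proof.
have df : differentiable (fun y => nablac i y v w) x.
  by case: (christoffel_smooth nablac i v w 1) => + _; exact.
by rewrite /dchern !deriveE // linearN.
Qed.

Lemma dchern_bil u : bilinear2 (dchern u).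
Proof.
have Gd v w := @connection_derivable nablac x u v w Vx.
split=> [v c w w'|w c v v'].
  have -> : dchern u v (c *: w + w') =
    'D_u ((c \*: (fun y => nablac i y v w)) + (fun y => nablac i y v w')) x.
    apply: (derive_on _ oV Vx) => y Vy.
    by have Gb := christoffel_bilinear nablac Vy; rewrite (bilD2 Gb) (bilZ2 Gb).
  by rewrite deriveD ?deriveZ //; exact: derivableZ.
have -> : dchern u (c *: v + v') w =
    'D_u ((c \*: (fun y => nablac i y v w)) + (fun y => nablac i y v' w)) x.
  apply: (derive_on _ oV Vx) => y Vy.
  by have Gb := christoffel_bilinear nablac Vy; rewrite (bilD1 Gb) (bilZ1 Gb).
by rewrite deriveD ?deriveZ //; exact: derivableZ.
Qed.

Lemma dchernJ2 u v w : dchern u (J v) w = J (dchern u v w).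
Proof.
have Gd := @connection_derivable nablac x u v w Vx.
have [_ <-] := is_derive_Jmap oV Vx Gd.
by apply: (derive_on _ oV Vx) => y Vy; exact: chern_J1.
Qed.

Lemma dchernJ3 u v w : dchern u v (J w) = J (dchern u v w).
Proof.
have Gd := @connection_derivable nablac x u v w Vx.
have [_ <-] := is_derive_Jmap oV Vx Gd.
by apply: (derive_on _ oV Vx) => y Vy; exact: chern_J2.
Qed.

Lemma tau_derivable u v w : derivable (fun y => tau y v w) x u.
Proof.
have Gd v w := @connection_derivable nablac x u v w Vx.
by apply: derivableZ; apply: derivableB.
Qed.

Lemma sig_derivable u v w : derivable (fun y => sig y v w) x u.
Proof.
have Gd v w := @connection_derivable nablac x u v w Vx.
have Sd v w := @connection_derivable nablas x u v w Vx.
apply: derivableD; last exact: tau_derivable.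
by apply: derivableZ; apply: derivableB.
Qed.

Lemma dtauE u v w : dtau u v w = 2^-1 *: (dchern u v w - dchern u w v).
Proof.
have Gd v w := @connection_derivable nablac x u v w Vx.
have -> : dtau u v w
  = 'D_u (2^-1 \*: ((fun y => nablac i y v w) - (fun y => nablac i y w v))) x by [].
by rewrite deriveZ ?deriveB //; exact: derivableB.
Qed.

Local Notation nt := (cov_tau (nablac i x) (tau x) dtau).
Local Notation ns := (cov_sig (nablac i x) (sig x) dsig).

Let gb := g_bil Vx.

Lemma derive_metric_l (F : E -> E) u z : derivable F x u ->
  'D_u (fun y => g i y (F y) z) x
  = g i x (nablac i x u (F x)) z + g i x (F x) (nablac i x u z) + g i x ('D_u F x) z.
Proof.
move=> Fd; have [Cm _ _] := nablacP.
have [_ ->] := is_derive_lin (l := fun y p => g i y p z) oV Vx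
  (fun y Vy c p q => (metric_bilinear g Vy).2 z c p q)
  (fun p => @metric_derivable x u p z Vx) Fd.
by rewrite (metric_compat Vx (F x) z u Cm).
Qed.

(** [sig_adj] differentiated along u; compatibility of g with the Chern connection turns plain
    derivatives into covariant ones. *)
Lemma cov_sig_adj u v w z : g i x (ns u v w) z = g i x w (nt u v z).
Proof.
have gsx u' v' : g i x u' v' = g i x v' u' := Defs.metric_sym g u' v' Vx.
have E1 := derive_metric_l z (@sig_derivable u v w).
have E2 := derive_metric_l w (@tau_derivable u v z).
have E0 : 'D_u (fun y => g i y (sig y v w) z) x = 'D_u (fun y => g i y (tau y v z) w) x.
  apply: (derive_on _ oV Vx) => y Vy.
  by rewrite sig_adj // (Defs.metric_sym g _ _ Vy).
move: E0; rewrite E1 E2 /cov_sig /cov_tau -/(dsig u v w) -/(dtau u v z).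
move: (sig_adj Vx).
move: (sig x) (tau x) (dsig u v w) (dtau u v z) => sg ta ds dt sa.
rewrite !(bilB1 gb) !(bilD1 gb) !(bilB2 gb) !(bilD2 gb) !sa.
rewrite (gsx dt) (gsx (nablac i x u (ta v z))) (gsx (ta v z) (nablac i x u w)).
lra.
Qed.

Definition canon_a (p : R * R) : R := 1 - p.1 * (1 - p.2).

Lemma sig_bil y : V y -> bilinear2 (sig y).
Proof.
move=> Vy; have Gb := christoffel_bilinear nablac Vy.
have Sb := christoffel_bilinear nablas Vy.
split=> [u c v v'|u c v v']; rewrite /chern_sig /tau
  ?(bilD1 Gb, bilD2 Gb, bilZ1 Gb, bilZ2 Gb, bilD1 Sb, bilD2 Sb, bilZ1 Sb, bilZ2 Sb);
  by apply/rowP => k; rewrite !mxE; ring.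
Qed.

Lemma curvature_canonical (p : R * R) u v w :
  curvature_op (canonical_connection nabla nablac nablas p) i x u v w
  = curv (tau x) (sig x) nt ns (canon_a p) p.2 (curv_of (nablac i x) dchern) u v w.
Proof.
set D := canonical_connection nabla nablac nablas p.
have DE y : V y -> forall u v, D i y u v
    = nablac i y u v + cA (tau y) (sig y) (canon_a p) p.2 u v.
  by move=> Vy u' v'; exact: canonicalE.
have covE v' w' : cov D i (cst v') (cst w') = (fun y => D i y v' w').
  by apply/funext => y; rewrite cov_cst.
have dD u' v' w' : 'D_u' (fun y => D i y v' w') x
    = dchern u' v' w' + dA dtau dsig (canon_a p) p.2 u' v' w'.
  rewrite (derive_on _ oV Vx (fun y Vy => DE y Vy v' w')).
  apply: derive_lincomb; first exact: connection_derivable.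
  - exact: tau_derivable.
  - exact: sig_derivable.
  - exact: sig_derivable.
apply: etrans; last first.
  by apply: (@curv_of_add _ _ (nablac i x) (tau x) (sig x)
    (christoffel_bilinear nablac Vx) (sig_bil Vx)).
rewrite /curvature_op !covE /cov !dD !DE //.
by rewrite [- (_ + (_ + _))]opprD addrACA addrA.
Qed.

End DerivativeAtPoint.
End HermitianTorsion.

(** * Kahler-like canonical connections *)

Section RealTrace.
Context {R : realType} {n : nat}.
Local Notation E := (Cspace R n).

(** Taken over the fixed coordinate basis, so that it can be differentiated along the chart. *)
Definition rtrace (L : E -> E) : R := \sum_A (L (delta_mx 0 A)) 0 A.

Lemma linear_coord (L : E -> E) x A : linear L ->
  (L x) 0 A = \sum_B x 0 B * (L (delta_mx 0 B)) 0 A.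
Proof.
move=> linL.
pose L' : {linear E -> E} := HB.pack L (GRing.isLinear.Build _ _ _ _ L linL).
rewrite {1}(row_sum_delta x) -[L]/(L' : E -> E) linear_sum summxE.
by apply: eq_bigr => B _; rewrite linearZ mxE.
Qed.

Lemma rtrace_comm (L L' : E -> E) : linear L -> linear L' ->
  rtrace (fun w => L (L' w)) = rtrace (fun w => L' (L w)).
Proof.
move=> lL lL'; rewrite /rtrace.
under eq_bigr => A _ do rewrite (linear_coord _ _ lL).
under [RHS]eq_bigr => A _ do rewrite (linear_coord _ _ lL').
rewrite exchange_big; apply: eq_bigr => B _; apply: eq_bigr => A _.
by rewrite mulrC.
Qed.

Lemma rtraceD (L L' : E -> E) :
  rtrace (fun w => L w + L' w) = rtrace L + rtrace L'.
Proof. by rewrite /rtrace -big_split; apply: eq_bigr => A _; rewrite mxE. Qed.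

Lemma rtraceZ (c : R) (L : E -> E) : rtrace (fun w => c *: L w) = c * rtrace L.
Proof. by rewrite /rtrace mulr_sumr; apply: eq_bigr => A _; rewrite mxE. Qed.

Lemma rtraceN (L : E -> E) : rtrace (fun w => - L w) = - rtrace L.
Proof. by rewrite /rtrace -sumrN; apply: eq_bigr => A _; rewrite mxE. Qed.

Lemma eq_rtrace (L L' : E -> E) : L =1 L' -> rtrace L = rtrace L'.
Proof. by move=> LL'; apply: eq_bigr => A _; rewrite LL'. Qed.

Lemma rtrace_herm (g : E -> E -> R) (e : 'I_n -> E) (L : E -> E) :
  bilinear2 (g : E -> E -> R^o) -> (forall x y, g x y = g y x) ->
  (forall x y, g (Jmap x) (Jmap y) = g x y) -> unitary g e -> linear L ->
  (forall w, L (Jmap w) = Jmap (L w)) ->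
  rtrace L = 2 * complex.Re (\sum_i herm g (L (e i)) (e i)).
Proof.
move=> gb gs gJ eP lL LJ; rewrite /rtrace (frame_trace gb gs gJ eP lL).
rewrite (raddf_sum (@complex.Re R : {additive Rcomplex R -> R})) mulr_sumr.
by apply: eq_bigr => i _; rewrite LJ gJ /= mulr_natl mulr2n.
Qed.

(** The imaginary part of T v is minus the real part of T (J v). *)
Lemma complex_trace_eq0 (T : E -> R[i]) :
  (forall v, T (Jmap v) = 'i%C * T v) -> (forall v, complex.Re (T v) = 0) ->
  forall v, T v = 0.
Proof.
move=> TJ T0 v; have := T0 (Jmap v); have := T0 v; rewrite TJ.
by case: (T v) => p q /=; rewrite mul0r mul1r sub0r => -> /eqP; rewrite oppr_eq0 => /eqP ->.
Qed.

End RealTrace.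

Section KahlerLike.
Context {R : realType} {n : nat} {M : complexManifold R n}.
Local Notation E := (Cspace R n).
Local Notation J := Jmap.
Variables (g : hermitianMetric M) (nabla nablac nablas : connection M).
Hypothesis nablaP : levi_civita g nabla.
Hypothesis nablacP : chern g nablac.
Hypothesis nablasP : strominger g nablas.
Variable i : chart_idx M.
Local Notation V := (@chart_img _ _ M i).
Implicit Types u v w z : E.
Local Notation tau := (chern_tau nablac i).
Local Notation sig := (chern_sig nablac nablas i).
Local Notation canon := (canonical_connection nabla nablac nablas).

Section AtPoint.
Variable x : E.
Hypothesis Vx : V x.
Local Notation G := (nablac i x).
Local Notation t := (tau x).
Local Notation sg := (sig x).
Local Notation dtau := (dchern_tau nablac i x).
Local Notation nt := (cov_tau G t dtau).
Local Notation ns := (cov_sig G sg (dchern_sig nablac nablas i x)).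
Local Notation Rc := (curv_of G (dchern nablac i x)).
Local Notation gx := (metric g i x).
Let gb : bilinear2 (gx : E -> E -> R^o) := g_bil g Vx.
Let gs u v : gx u v = gx v u := Defs.metric_sym g u v Vx.
Let gJ u v : gx (J u) (J v) = gx u v := metric_J g u v Vx.
Let gp u : u != 0 -> 0 < gx u u. Proof. exact: metric_pos. Qed.

Let Gb := christoffel_bilinear nablac Vx.
Let GJ1 := chern_J1 nablacP Vx.
Let GJ2 := chern_J2 nablacP Vx.
Let tE u v : t u v = 2^-1 *: (G u v - G v u). Proof. by []. Qed.
Let dtE := dtauE nablac Vx.
Let dN := dchernN nablac Vx.
Let dJ2 := dchernJ2 nablacP Vx.
Let dJ3 := dchernJ3 nablacP Vx.
Let db := dchern_bil nablac Vx.

Lemma t_bil : bilinear2 t. Proof. exact: (tau_bil Gb tE). Qed.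
Lemma t_skew u v : t u v = - t v u. Proof. exact: (tau_skew tE). Qed.
Lemma t_J u v : t (J u) v = J (t u v). Proof. exact: (tau_J GJ1 GJ2 tE). Qed.
Lemma nt_skew u v w : nt u v w = - nt u w v. Proof. exact: (cov_tau_skew Gb tE dtE). Qed.
Lemma nt_N u v w : nt (- u) v w = - nt u v w. Proof. exact: (cov_tauN Gb tE dN dtE). Qed.
Lemma nt_J u v w : nt u (J v) w = J (nt u v w).
Proof. exact: (cov_tauJ GJ1 GJ2 tE dJ2 dJ3 dtE). Qed.
Lemma nt_bil u : bilinear2 (nt u). Proof. exact: (cov_tau_bil Gb tE db dtE). Qed.

Lemma kahler_like_curv p : kahler_like g (canon p) ->
  let C := curv t sg nt ns (canon_a p) p.2 Rc in
  [/\ forall u v w, C u v w + C v w u + C w u v = 0,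
      forall u v w, C (J u) (J v) w = C u v w &
      forall u v w, C u v (J w) = J (C u v w)].
Proof.
move=> kl C.
have CE u v w : curvature_op (canon p) i x u v w = C u v w.
  exact: (curvature_canonical nablaP nablacP nablasP Vx).
clearbody C.
have kl' u v w z := kl i x u v w z Vx.
rewrite /curvature in kl'.
split=> u v w; apply: (g_inj gb gp) => z.
- by rewrite !(bilD1 gb) (bil01 gb) -!CE; case: (kl' u v w z).
- by rewrite -!CE; case: (kl' u v w z).
- rewrite -!CE (gJl gb gJ) -(bilN2 gb) -JmapN.
  have [_ _ <-] := kl' u v w (J (- z)).
  by rewrite JmapK opprK.
Qed.

Lemma kahler_like_facts p : kahler_like g (canon p) ->
  let a := canon_a p in let s := p.2 in
  [/\ forall u v z, quad t nt a u v z = 0,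
      forall z u v w, ppm gx t sg nt a s z u v w = 0,
      forall z u v w, pmm gx t nt a s z u v w = 0,
      forall z u v w, dpart gx t sg nt a s z u v w = 0 &
      forall u v w, bianchi20 t nt u v w = 0].
Proof.
move=> kl a s; have [kB kJ12 kJ3] := kahler_like_curv kl.
have sa := sig_adj nablacP nablasP Vx.
have na := cov_sig_adj nablacP nablasP Vx.
have rN1 := curv_ofN1 Gb dN db.
have rJ := curv_ofJ GJ2 dJ3.
have rt := curv_of_type GJ1 GJ2 dJ2.
have rb := curv_of_bianchi Gb tE dtE.
split.
- exact: (kl_quad gb gp gJ t_bil t_skew t_J sa nt_skew nt_N nt_J na rN1 rJ rt kJ12).
- move=> z u v w.
  by have [] := kl_parts gb gp gJ t_bil t_skew t_J sa nt_skew nt_N nt_J na rN1 rJ rt kJ12 z u v w.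
- exact: (kl_pmm gb gp gJ t_bil t_skew t_J sa nt_skew nt_N nt_J na rN1 rJ rt kJ12 kJ3).
- exact: (kl_dpart gb gp gJ t_bil t_skew t_J sa nt_skew nt_N nt_J na rN1 rJ rt rb kB kJ12 kJ3).
- exact: (kl_bianchi20 gb gp gJ t_bil t_skew t_J sa nt_skew nt_N nt_J na rN1 rJ rt rb kB kJ12 kJ3).
Qed.

Local Notation lin := (ntl nt).
Local Notation anti := (nta nt).

Lemma anti_bil u : bilinear2 (anti u).
Proof.
have b1 := nt_bil u; have b2 := nt_bil (J u); rewrite /nta.
split=> [v c w w'|w c v v'].
  rewrite (bilD2 b1) (bilZ2 b1) (bilD2 b2) (bilZ2 b2) JmapD JmapZ.
  move: (nt u v w) (nt u v w') (J _) (J _) => p q r s.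
  by apply/rowP => k; rewrite !mxE; ring.
rewrite (bilD1 b1) (bilZ1 b1) (bilD1 b2) (bilZ1 b2) JmapD JmapZ.
move: (nt u v w) (nt u v' w) (J _) (J _) => p q r s.
by apply/rowP => k; rewrite !mxE; ring.
Qed.

Lemma lin_quad p : kahler_like g (canon p) -> canon_a p != 0 ->
  forall z u v, lin z u v = (canon_a p - 2) *: torX t z u v.
Proof.
move=> kl a0; have [kq _ _ _ kb] := kahler_like_facts kl.
exact: (quad_torsion t_bil t_skew (ntl_anti nt_skew) a0 kq kb).
Qed.

(** [pmm] pairs an arbitrary u with a vector multiplied by s; dividing by s gives the second
    multiple, - a. *)
Lemma lin_cross p : kahler_like g (canon p) -> p.2 != 0 ->
  forall z u v, lin z u v = (- canon_a p) *: torX t z u v.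
Proof.
move=> kl s0 v w z; have [_ _ kp _ _] := kahler_like_facts kl.
apply/eqP; rewrite scaleNr -addr_eq0; apply/eqP.
apply: (g_eq0 gp) => u; have := kp z u v w; rewrite /pmm.
have s0' : (p.2)%:C%C != 0 :> R[i] by rewrite -(inj_eq (@complexI R)) in s0.
rewrite /torX (t_skew w (t v z)) (t_skew v z) (bilN1 t_bil) opprK.
move: (lin v w z) (t (t v w) z) (t (t z v) w) => p1 p2 p3 E.
rewrite (hermDr gb) (hermZr gb) (hermDr gb).
by apply: (mulfI s0'); rewrite mulr0; apply: oppr_inj; rewrite oppr0 -[RHS]E; ring.
Qed.

Lemma lin_bianchi p : kahler_like g (canon p) ->
  forall u v w, 2 *: (lin u v w + lin v w u + lin w u v) + 4 *: torS t u v w = 0.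
Proof.
by move=> kl; have [_ _ _ _ kb] := kahler_like_facts kl.
Qed.

Lemma nilpotent_one p : kahler_like g (canon p) -> p.2 != 0 -> canon_a p != 0 ->
  canon_a p != 1 -> forall u v w, t (t u v) w = 0.
Proof.
move=> kl s0 a0 a1; have l1 := lin_quad kl a0; have l2 := lin_cross kl s0.
apply: (nilpotent_torsion _ l1 l2).
  by apply: contra a1 => /eqP e; apply/eqP; lra.
apply: (jacobi_torsion _ l1 (lin_bianchi kl)).
by apply: contra a1 => /eqP e; apply/eqP; lra.
Qed.

Lemma nilpotent_two p p' : kahler_like g (canon p) -> kahler_like g (canon p') ->
  canon_a p != 0 -> canon_a p' != 0 -> canon_a p != canon_a p' ->
  forall u v w, t (t u v) w = 0.
Proof.
move=> kl kl' a0 a0' aa'; have l1 := lin_quad kl a0; have l2 := lin_quad kl' a0'.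
apply: (nilpotent_torsion _ l1 l2).
  by apply: contra aa' => /eqP e; apply/eqP; lra.
have [a1|a1] := eqVneq (canon_a p) 1.
  apply: (jacobi_torsion _ l2 (lin_bianchi kl)).
  by apply: contra aa' => /eqP e; apply/eqP; rewrite a1; lra.
apply: (jacobi_torsion _ l1 (lin_bianchi kl)).
by apply: contra a1 => /eqP e; apply/eqP; lra.
Qed.

(** The multiples - a and a' - 2 agree exactly when a + a' = 2. Otherwise a or a' differs from 1,
    and that one yields the Jacobi identity. *)
Lemma nilpotent_mixed p p' : kahler_like g (canon p) -> kahler_like g (canon p') ->
  p.2 != 0 -> canon_a p' != 0 -> canon_a p + canon_a p' != 2 ->
  forall u v w, t (t u v) w = 0.
Proof.
move=> kl kl' s0 a0' aa'; have l1 := lin_cross kl s0; have l2 := lin_quad kl' a0'.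
apply: (nilpotent_torsion _ l1 l2).
  by apply: contra aa' => /eqP e; apply/eqP; lra.
have [a1|a1] := eqVneq (canon_a p) 1.
  apply: (jacobi_torsion _ l2 (lin_bianchi kl)).
  by apply: contra aa' => /eqP e; apply/eqP; rewrite a1; lra.
apply: (jacobi_torsion _ l1 (lin_bianchi kl)).
by apply: contra a1 => /eqP e; apply/eqP; lra.
Qed.

Lemma jacobi_zero p : kahler_like g (canon p) -> p.2 != 0 -> canon_a p = 0 ->
  forall u v w, torS t u v w = 0.
Proof.
move=> kl s0 a0; have l1 := lin_cross kl s0.
apply: (jacobi_torsion _ l1 (lin_bianchi kl)); rewrite a0 oppr0 eq_sym oppr_eq0.
exact: oner_neq0.
Qed.

Section Frame.
Variable e : 'I_n -> E.
Hypothesis eP : unitary gx e.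
Local Notation tc := (torsion_comp gx t e).
Local Notation dc := (dtorsion_comp gx anti e).

Lemma tc_anti j a k : tc j a k = - tc j k a.
Proof. exact: (tcomp_anti gb t_skew). Qed.
Lemma dc_anti j a k l : dc j a k l = - dc j k a l.
Proof. exact: (dcomp_anti gb (nta_anti nt_skew)). Qed.

Let hs := h_sig t_skew t_J (sig_adj nablacP nablasP Vx).

Lemma tc_first p : kahler_like g (canon p) ->
  kl_first tc dc (canon_a p)%:C%C (p.2)%:C%C.
Proof.
move=> kl; have [_ _ _ kd _] := kahler_like_facts kl.
exact: (comp_first gb gs gJ t_bil t_skew t_J hs (nta_anti nt_skew) eP kd).
Qed.

Lemma tc_second p : kahler_like g (canon p) ->
  kl_second tc dc (canon_a p)%:C%C (p.2)%:C%C.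
Proof.
move=> kl; have [_ kd _ _ _] := kahler_like_facts kl.
exact: (comp_second gb gs gJ t_bil t_skew t_J hs eP kd).
Qed.

Lemma tc_eq0 : (forall j a k, tc j a k = 0) -> forall u v, t u v = 0.
Proof. exact: (tcomp_eq0 gb gs gp gJ t_bil t_skew t_J eP). Qed.

Lemma tc_nilpotent : (forall u v w, t (t u v) w = 0) ->
  forall k l a j, \sum_m tc m k l * tc j m a = 0.
Proof.
move=> tt k l a j; rewrite -(comp_tau2 gb gs gJ t_bil t_J eP) tt.
exact: herm0l.
Qed.

Lemma tc_jacobi : (forall u v w, torS t u v w = 0) -> forall k l a j,
  \sum_m (tc m k l * tc j m a + tc m l a * tc j m k + tc m a k * tc j m l) = 0.
Proof.
move=> tt k l a j; rewrite !big_split /= -!(comp_tau2 gb gs gJ t_bil t_J eP).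
rewrite -!(hermDl gb) -/(torS t (e k) (e l) (e a)) tt.
exact: herm0l.
Qed.

End Frame.
End AtPoint.
End KahlerLike.

(** * Derivatives of trace identities *)

Section TorsionTrace.
Context {R : realType} {n : nat} {M : complexManifold R n}.
Local Notation E := (Cspace R n).
Local Notation J := Jmap.
Variables (g : hermitianMetric M) (nabla nablac nablas : connection M).
Hypothesis nablaP : levi_civita g nabla.
Hypothesis nablacP : chern g nablac.
Hypothesis nablasP : strominger g nablas.
Variable i : chart_idx M.
Local Notation V := (@chart_img _ _ M i).
Implicit Types u v w z : E.
Local Notation tau := (chern_tau nablac i).
Local Notation canon := (canonical_connection nabla nablac nablas).

Section AtPoint.
Variable x : E.
Hypothesis Vx : V x.
Let oV : open V := @chart_img_open _ _ M i.
Local Notation G := (nablac i x).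
Local Notation t := (tau x).
Local Notation dtau := (dchern_tau nablac i x).
Local Notation nt := (cov_tau G t dtau).
Local Notation gx := (metric g i x).
Let gb : bilinear2 (gx : E -> E -> R^o) := g_bil g Vx.
Let gs u v : gx u v = gx v u := Defs.metric_sym g u v Vx.
Let gJ u v : gx (J u) (J v) = gx u v := metric_J g u v Vx.
Let tb : bilinear2 t := t_bil nablac Vx.
Let ts := t_skew nablac i x.
Let tJ := t_J nablacP Vx.
Let tJ2 := tauJ2 ts tJ.
Let Gb := christoffel_bilinear nablac Vx.
Let nts := nt_skew nablac Vx.
Let ntJ := nt_J nablacP Vx.
Local Notation lin := (ntl nt).
Local Notation anti := (nta nt).

Lemma derive_rtrace u v :
  'D_u (fun y => rtrace (tau y v)) x = rtrace (dtau u v).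
Proof.
have td w := @tau_derivable _ _ _ nablac i x Vx u v w.
have dA A := is_derive_coord A (td (delta_mx 0 A)).
have -> : (fun y => rtrace (tau y v))
    = \sum_A (fun y => tau y v (delta_mx 0 A) 0 A).
  by apply/funext => y; rewrite fct_sumE.
rewrite derive_sum => [|A]; last by case: (dA A).
by apply: eq_bigr => A _; case: (dA A).
Qed.

(** Two of the correction terms form the commutator of [G u] and [t v], which is traceless. *)
Lemma rtrace_cov u v : rtrace (nt u v) = rtrace (dtau u v) - rtrace (t (G u v)).
Proof.
rewrite /cov_tau (eq_rtrace (L' := fun w => (dtau u v w + G u (t v w))
  + ((- t (G u v) w) + - t v (G u w)))); last by move=> w; rewrite !addrA.
rewrite rtraceD rtraceD rtraceD !rtraceN.
by rewrite (rtrace_comm (Gb.1 u) (tb.1 v)); ring.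
Qed.

Lemma rtrace_bracket a b : (forall u v w, torS t u v w = 0) ->
  rtrace (t (t a b)) = 0.
Proof.
move=> tS; rewrite (eq_rtrace (L' := fun w => t a (t b w) + - t b (t a w))).
  by rewrite rtraceD rtraceN (rtrace_comm (tb.1 a) (tb.1 b)) subrr.
move=> w; have := tS a b w; rewrite /torS (ts (t b w)) (ts (t w a)) (ts w a).
rewrite (bilN2 tb) opprK => E0.
by apply/eqP; rewrite -subr_eq0 -E0; apply/eqP; apply/rowP => k; rewrite !mxE; ring.
Qed.

Section TraceFree.
Hypothesis tr0 : forall y, V y -> forall v, rtrace (tau y v) = 0.

Lemma rtrace_lin u v : rtrace (lin u v) = 0.
Proof.
have nt0 u' v' : rtrace (nt u' v') = 0.
  rewrite rtrace_cov tr0 // subr0 -derive_rtrace.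
  rewrite (derive_on _ oV Vx (f' := cst 0)) ?derive_cst // => y Vy.
  exact: tr0.
rewrite (eq_rtrace (L' := fun w => 2^-1 *: (nt u v w + - nt (J u) (J v) w))).
  by rewrite rtraceZ rtraceD rtraceN !nt0 subrr mulr0.
by move=> w; rewrite ntJ.
Qed.

Variable e : 'I_n -> E.
Hypothesis eP : unitary gx e.
Local Notation tc := (torsion_comp gx t e).

(** In the trace of w -> [torX t u v w] one term is the trace of ad of a bracket, which vanishes,
    and the other is the Killing form. The sign in the hypothesis is the multiple - a at a = 1. *)
Lemma killing_zero : (forall z u v, lin z u v = - torX t z u v) ->
  forall a k, \sum_m \sum_j tc m j a * tc j m k = 0.
Proof.
move=> lE a k.
have K0 u v : rtrace (fun w => t (t w u) v) = 0.
  have := rtrace_lin u v; rewrite (eq_rtrace (lE u v)) rtraceN rtraceD tr0 //.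
  by rewrite add0r => /eqP; rewrite oppr_eq0 => /eqP.
pose T v := \sum_j herm gx (t (t (e j) (e a)) v) (e j).
have T0 : forall v, T v = 0.
  apply: complex_trace_eq0 => v.
    by rewrite /T mulr_sumr; apply: eq_bigr => j _; rewrite tJ2 (hermJl gb gJ).
  have lL : linear (fun w => t (t w (e a)) v).
    by move=> c w w'; rewrite (bilD1 tb) (bilZ1 tb) (bilD1 tb) (bilZ1 tb).
  have LJ w : t (t (J w) (e a)) v = J (t (t w (e a)) v) by rewrite !tJ.
  have := rtrace_herm gb gs gJ eP lL LJ; rewrite K0 => /esym/eqP.
  by rewrite mulf_eq0 pnatr_eq0 /= => /eqP.
rewrite exchange_big -[RHS](T0 (e k)); apply: eq_bigr => j _.
by rewrite (comp_tau2 gb gs gJ tb tJ eP).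
Qed.

End TraceFree.

Section TraceJacobi.
Hypothesis tS : forall y, V y -> forall u v w, torS (tau y) u v w = 0.

(** Derivative of tr (ad [a, b]) = 0 along u; the corrections in G cancel or are again traces of ad
    of brackets. *)
Lemma rtrace_derived u a b :
  rtrace (nt u (t a b)) + rtrace (t (nt u a b)) = 0.
Proof.
have trl y c p q : V y -> rtrace (tau y (c *: p + q)) =
    c * rtrace (tau y p) + rtrace (tau y q).
  move=> Vy; have yb := t_bil nablac Vy.
  rewrite (eq_rtrace (L' := fun w => c *: tau y p w + tau y q w)).
    by rewrite rtraceD rtraceZ.
  by move=> w; rewrite (bilD1 yb) (bilZ1 yb).
have trd p : derivable (fun y => rtrace (tau y p)) x u.
  have -> : (fun y => rtrace (tau y p))
      = \sum_A (fun y => tau y p (delta_mx 0 A) 0 A).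
    by apply/funext => y; rewrite fct_sumE.
  apply: derivable_sum => A.
  by case: (is_derive_coord A (@tau_derivable _ _ _ nablac i x Vx u p (delta_mx 0 A))).
have [_] := is_derive_lin oV Vx (l := fun y p => rtrace (tau y p))
  (fun y Vy c p q => trl y c p q Vy) trd (@tau_derivable _ _ _ nablac i x Vx u a b).
rewrite (derive_on _ oV Vx (f' := cst 0)) ?derive_cst; last first.
  move=> y Vy; have yb := t_bil nablac Vy; have ys := t_skew nablac i y.
  rewrite /= (eq_rtrace (L' := fun w => tau y a (tau y b w) + - tau y b (tau y a w))).
    by rewrite rtraceD rtraceN (rtrace_comm (yb.1 a) (yb.1 b)) subrr.
  move=> w; have := tS Vy a b w.
  rewrite /torS (ys (tau y b w)) (ys (tau y w a)) (ys w a).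
  rewrite (bilN2 yb) opprK.
  move: (tau y (tau y a b) w) (tau y a (tau y b w)) (tau y b (tau y a w)).
  by move=> p q r /rowP E0; apply/rowP => k; move: (E0 k); rewrite !mxE; lra.
rewrite derive_rtrace => /esym E0; rewrite -[RHS]E0 rtrace_cov.
rewrite -/(dtau u a b).
have tl c p q : rtrace (t (c *: p + q)) = c * rtrace (t p) + rtrace (t q).
  exact: trl.
have tD p q : rtrace (t (p + q)) = rtrace (t p) + rtrace (t q).
  by have := tl 1 p q; rewrite scale1r mul1r.
have tN p : rtrace (t (- p)) = - rtrace (t p).
  rewrite -rtraceN; apply: eq_rtrace => w; exact: bilN1.
rewrite [nt u a b]/cov_tau !tD !tN !(rtrace_bracket _ _ (tS Vx)).
ring.
Qed.

Variable e : 'I_n -> E.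
Hypothesis eP : unitary gx e.
Local Notation tc := (torsion_comp gx t e).
Local Notation dc := (dtorsion_comp gx anti e).

(** With zero (1,0)-derivative [nt] is its own (0,1)-part. The identity along e_l is then complex
    linear in the first bracket argument v, so its real trace determines the complex one. *)
Lemma trace_jacobi_zero : (forall z u v, lin z u v = 0) ->
  forall l a b, \sum_c (tc c a b * (\sum_m dc m c m l)
    + dc c a b l * (\sum_m tc m c m)) = 0.
Proof.
move=> l0 l a b.
have ntE u v w : nt u v w = anti u v w by rewrite nt_split l0 add0r.
have ab u := anti_bil nablac Vx u.
have aJ := ntaJ2 ntJ; have aJ3 := ntaJ3 nts ntJ.
pose T v := \sum_j (herm gx (anti (e l) (t v (e b)) (e j)) (e j)
  + herm gx (t (anti (e l) v (e b)) (e j)) (e j)).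
have T0 : forall v, T v = 0.
  apply: complex_trace_eq0 => v.
    rewrite /T mulr_sumr; apply: eq_bigr => j _.
    by rewrite tJ !aJ tJ !(hermJl gb gJ) mulrDr.
  have lL : linear (fun w => anti (e l) (t v (e b)) w + t (anti (e l) v (e b)) w).
    move=> c w w'; rewrite (bilD2 (ab _)) (bilZ2 (ab _)) (bilD2 tb) (bilZ2 tb).
    move: (anti _ _ w) (anti _ _ w') (t _ w) (t _ w') => p q r s.
    by apply/rowP => k; rewrite !mxE; ring.
  have LJ w : anti (e l) (t v (e b)) (J w) + t (anti (e l) v (e b)) (J w)
      = J (anti (e l) (t v (e b)) w + t (anti (e l) v (e b)) w).
    by rewrite JmapD aJ3 tJ2.
  have := rtrace_herm gb gs gJ eP lL LJ.
  rewrite rtraceD -(eq_rtrace (ntE _ _)) -ntE rtrace_derived => /esym/eqP.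
  rewrite mulf_eq0 pnatr_eq0 /= => /eqP; rewrite /T => E0.
  apply: etrans E0; congr complex.Re; apply: eq_bigr => j _.
  by rewrite (hermDl gb (anti (e l) (t v (e b)) (e j))) ntE.
rewrite -[RHS](T0 (e a)) /T big_split [in RHS]big_split /=; congr (_ + _).
  transitivity (\sum_c \sum_m tc c a b * dc m c m l).
    by apply: eq_bigr => c _; rewrite mulr_sumr.
  rewrite exchange_big; apply: eq_bigr => m _.
  by rewrite (h_nta_expand gb gs gJ ab aJ eP).
transitivity (\sum_c \sum_m dc c a b l * tc m c m).
  by apply: eq_bigr => c _; rewrite mulr_sumr.
rewrite exchange_big; apply: eq_bigr => m _.
by rewrite (h_tau_expand gb gs gJ tb tJ eP).
Qed.

End TraceJacobi.
End AtPoint.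
End TorsionTrace.

(** * Vanishing of the torsion, by cases on (a, s) *)

Section Vanishing.
Context {R : realType} {n : nat} {M : complexManifold R n}.
Local Notation E := (Cspace R n).
Local Notation J := Jmap.
Variables (g : hermitianMetric M) (nabla nablac nablas : connection M).
Hypothesis nablaP : levi_civita g nabla.
Hypothesis nablacP : chern g nablac.
Hypothesis nablasP : strominger g nablas.
Variable i : chart_idx M.
Local Notation V := (@chart_img _ _ M i).
Local Notation tau := (chern_tau nablac i).
Local Notation canon := (canonical_connection nabla nablac nablas).
Local Notation "x %:C" := (real_complex R x).
Implicit Types (p q : R * R) (x : E).

Let unitary_frame x : V x -> exists e : 'I_n -> E, unitary (metric g i x) e.
Proof.
move=> Vx; apply: (unitary_exists (g_bil g Vx)) => //.
- by move=> u v; exact: (Defs.metric_sym g u v Vx).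
- by move=> u; exact: metric_pos.
- by move=> u v; exact: metric_J.
Qed.

Let real_conj (c : R) : (c%:C)^* = c%:C. Proof. exact: conjc_real. Qed.

Let real_neq0 (c : R) : c != 0 -> c%:C != 0.
Proof. by move=> c0; rewrite -(inj_eq (@complexI R)) in c0. Qed.

Let real_sqr_neq (c d : R) : c ^+ 2 != d -> c%:C ^+ 2 != d%:C.
Proof. by rewrite -rmorphXn (inj_eq (@complexI R)). Qed.

Let real_neq (c d : R) : c != d -> c%:C != d%:C.
Proof. by rewrite (inj_eq (@complexI R)). Qed.

(** The pairs (a, s) of nabla, nabla', nabla^+ and nabla^-. *)
Definition exceptional p :=
  (canon_a p == 1) && (p.2 ^+ 2 == 1) || (canon_a p == 0) && (p.2 ^+ 2 == 4).

Let conj0 : (0 : R[i])^* = 0. Proof. exact: conjC0. Qed.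

Lemma torsion_eq0_one p : kahler_like g (canon p) -> p.2 != 0 -> ~~ exceptional p ->
  forall x, V x -> forall u v, tau x u v = 0.
Proof.
move=> kl s0 ex x Vx; have [e eP] := unitary_frame Vx.
have kd := tc_first nablaP nablacP nablasP Vx eP kl.
have kb := tc_second nablaP nablacP nablasP Vx eP kl.
have ta := tc_anti g nablac Vx e; have da := dc_anti g nablac Vx e.
apply: (tc_eq0 nablacP Vx eP).
move: ex; rewrite /exceptional negb_or !negb_and.
have [a1|a1] := eqVneq (canon_a p) 1 => /=.
  case/andP => s1 _; rewrite a1 rmorph1 in kd kb.
  apply: (kl_one_riemannian ta da (real_conj _) kd kb (real_neq0 s0)).
  by rewrite -(rmorph1 (real_complex R)) real_sqr_neq.
have [a0|a0] := eqVneq (canon_a p) 0 => /=.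
  move=> s4; rewrite a0 rmorph0 in kd kb.
  have jac y (Vy : V y) := jacobi_zero nablaP nablacP nablasP Vy kl s0 a0.
  apply: (kl_one_zero ta da (real_conj _) kd kb (real_neq0 s0)).
  - by rewrite -(rmorph_nat (real_complex R)) real_sqr_neq.
  - exact: (tc_jacobi nablacP Vx eP (jac x Vx)).
  - apply: (trace_jacobi_zero nablacP Vx jac eP) => z u v.
    by rewrite (lin_cross nablaP nablacP nablasP Vx kl s0) a0 oppr0 scale0r.
move=> _; have tt := nilpotent_one nablaP nablacP nablasP Vx kl s0 a0 a1.
apply: (kl_one_generic ta da (real_conj _) (real_conj _) kd kb (real_neq0 s0)).
  by rewrite -(rmorph1 (real_complex R)) real_neq.
exact: (tc_nilpotent nablacP Vx eP tt).
Qed.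

Lemma torsion_eq0_two p q : kahler_like g (canon p) -> kahler_like g (canon q) ->
  p.2 != 0 -> q.2 != 0 -> canon_a p != canon_a q ->
  forall x, V x -> forall u v, tau x u v = 0.
Proof.
move=> kl kl' s0 s0' aa x Vx; have [e eP] := unitary_frame Vx.
have kd := tc_first nablaP nablacP nablasP Vx eP kl.
have kb := tc_second nablaP nablacP nablasP Vx eP kl.
have kd' := tc_first nablaP nablacP nablasP Vx eP kl'.
have kb' := tc_second nablaP nablacP nablasP Vx eP kl'.
have ta := tc_anti g nablac Vx e; have da := dc_anti g nablac Vx e.
apply: (tc_eq0 nablacP Vx eP).
exact: (kl_two_generic ta da (real_conj _) (real_conj _) (real_conj _)
  (real_conj _) kd kb kd' kb' (real_neq0 s0) (real_neq0 s0') (real_neq aa)).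
Qed.

(** The pointwise [kl_chern_trace] carried to real traces at every point of the chart, as needed for
    differentiating it. *)
Lemma trace_free p q : kahler_like g (canon p) -> kahler_like g (canon q) ->
  p.2 != 0 -> canon_a p = 1 -> q.2 = 0 -> canon_a q = 0 ->
  forall x, V x -> forall v, rtrace (tau x v) = 0.
Proof.
move=> kl kl' s0 a1 s0' b0 x Vx v; have [e eP] := unitary_frame Vx.
have kb := tc_second nablaP nablacP nablasP Vx eP kl.
have kd := tc_first nablaP nablacP nablasP Vx eP kl'.
have ta := tc_anti g nablac Vx e; have da := dc_anti g nablac Vx e.
rewrite a1 rmorph1 in kb; rewrite s0' b0 rmorph0 in kd.
have V0 := kl_chern_trace ta da (real_neq0 s0) kb kd.
have gb := g_bil g Vx; have gs u w := Defs.metric_sym g u w Vx.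
have gJ u w := metric_J g u w Vx.
have tb := t_bil nablac Vx; have tJ := t_J nablacP Vx.
have tJ2 := tauJ2 (t_skew nablac i x) tJ.
rewrite (rtrace_herm gb gs gJ eP (tb.1 v) (tJ2 v)).
rewrite (_ : \sum_j _ = 0) ?mulr0 //.
under eq_bigr => j _ do rewrite (h_tau_expand gb gs gJ tb tJ eP).
rewrite exchange_big big1 // => m _ /=; rewrite -mulr_sumr.
by rewrite [X in _ * X](V0 m) mulr0.
Qed.

Lemma torsion_eq0_riemannian p q : kahler_like g (canon p) ->
  kahler_like g (canon q) -> p.2 != 0 -> canon_a p = 1 -> q.2 = 0 ->
  forall x, V x -> forall u v, tau x u v = 0.
Proof.
move=> kl kl' s0 a1 s0' x Vx; have [e eP] := unitary_frame Vx.
have kb := tc_second nablaP nablacP nablasP Vx eP kl.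
have kd := tc_first nablaP nablacP nablasP Vx eP kl'.
have ta := tc_anti g nablac Vx e; have da := dc_anti g nablac Vx e.
apply: (tc_eq0 nablacP Vx eP).
rewrite a1 rmorph1 in kb; rewrite s0' rmorph0 in kd.
have [b1|b1] := eqVneq (canon_a q) 1.
  rewrite b1 rmorph1 in kd.
  exact: (kl_riemannian_one ta da (real_conj _) (real_neq0 s0) kb kd).
have [b0|b0] := eqVneq (canon_a q) 0.
  rewrite b0 rmorph0 in kd.
  apply: (kl_riemannian_chern ta da (real_conj _) (real_neq0 s0) kb kd).
  have tr0 := trace_free kl kl' s0 a1 s0' b0.
  apply: (killing_zero nablacP Vx tr0 eP) => z u v.
  by rewrite (lin_cross nablaP nablacP nablasP Vx kl s0) a1 scaleN1r.
have tt : forall u v w, tau x (tau x u v) w = 0.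
  apply: (nilpotent_mixed nablaP nablacP nablasP Vx kl kl' s0 b0).
  by rewrite a1; apply: contra b1 => /eqP E0; apply/eqP; lra.
apply: (kl_riemannian_gauduchon ta da (real_conj _) (real_conj _) (real_neq0 s0) kb kd).
  by rewrite -(rmorph1 (real_complex R)) real_neq.
exact: (tc_nilpotent nablacP Vx eP tt).
Qed.

Lemma torsion_eq0_zero p q : kahler_like g (canon p) ->
  kahler_like g (canon q) -> p.2 != 0 -> canon_a p = 0 -> q.2 = 0 ->
  canon_a q != 2 -> forall x, V x -> forall u v, tau x u v = 0.
Proof.
move=> kl kl' s0 a0 s0' b2 x Vx; have [e eP] := unitary_frame Vx.
have kd := tc_first nablaP nablacP nablasP Vx eP kl.
have kb := tc_second nablaP nablacP nablasP Vx eP kl.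
have kd' := tc_first nablaP nablacP nablasP Vx eP kl'.
have ta := tc_anti g nablac Vx e; have da := dc_anti g nablac Vx e.
apply: (tc_eq0 nablacP Vx eP).
rewrite a0 rmorph0 in kb kd; rewrite s0' rmorph0 in kd'.
have [b0|b0] := eqVneq (canon_a q) 0.
  rewrite b0 rmorph0 in kd'.
  exact: (kl_zero_chern ta da (real_neq0 s0) kb kd').
have tt : forall u v w, tau x (tau x u v) w = 0.
  apply: (nilpotent_mixed nablaP nablacP nablasP Vx kl kl' s0 b0).
  by rewrite a0 add0r.
apply: (kl_one_generic ta da conj0 (real_conj _) kd kb (real_neq0 s0)).
  by rewrite eq_sym oner_neq0.
exact: (tc_nilpotent nablacP Vx eP tt).
Qed.

Lemma torsion_eq0_chern p q : kahler_like g (canon p) ->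
  kahler_like g (canon q) -> p.2 = 0 -> canon_a p = 0 -> q.2 = 0 ->
  canon_a q != 0 -> forall x, V x -> forall u v, tau x u v = 0.
Proof.
move=> kl kl' s0 a0 s0' b0 x Vx; have [e eP] := unitary_frame Vx.
have kd := tc_first nablaP nablacP nablasP Vx eP kl.
have kd' := tc_first nablaP nablacP nablasP Vx eP kl'.
have ta := tc_anti g nablac Vx e; have da := dc_anti g nablac Vx e.
apply: (tc_eq0 nablacP Vx eP).
rewrite a0 s0 rmorph0 in kd; rewrite s0' rmorph0 in kd'.
exact: (kl_chern_gauduchon ta da (real_conj _) (real_neq0 b0) kd kd').
Qed.

Lemma torsion_eq0_gauduchon p q : kahler_like g (canon p) ->
  kahler_like g (canon q) -> p.2 = 0 -> q.2 = 0 ->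
  canon_a p != canon_a q -> forall x, V x -> forall u v, tau x u v = 0.
Proof.
move=> kl kl' s0 s0' aa.
have [a0|a0] := eqVneq (canon_a p) 0.
  by apply: (torsion_eq0_chern kl kl') => //; rewrite eq_sym -a0.
have [b0|b0] := eqVneq (canon_a q) 0.
  exact: (torsion_eq0_chern kl' kl).
move=> x Vx; have [e eP] := unitary_frame Vx.
have kd := tc_first nablaP nablacP nablasP Vx eP kl.
have kd' := tc_first nablaP nablacP nablasP Vx eP kl'.
have ta := tc_anti g nablac Vx e; have da := dc_anti g nablac Vx e.
apply: (tc_eq0 nablacP Vx eP).
rewrite s0 rmorph0 in kd; rewrite s0' rmorph0 in kd'.
have tt := nilpotent_two nablaP nablacP nablasP Vx kl kl' a0 b0 aa.
apply: (kl_two_gauduchon ta da (real_conj _) (real_conj _) (real_neq0 a0)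
  (real_neq0 b0) (real_neq aa) kd kd').
exact: (tc_nilpotent nablacP Vx eP tt).
Qed.

(** The fundamental form is parallel for the Chern connection; without torsion, its exterior
    derivative is the alternation of a zero tensor. *)
Lemma kahler_of_torsion_eq0 x u v w : V x -> (forall u v, tau x u v = 0) ->
  'D_u (fun y => fundamental_form g i y v w) x
    - 'D_v (fun y => fundamental_form g i y u w) x
    + 'D_w (fun y => fundamental_form g i y u v) x = 0.
Proof.
move=> Vx t0; have [Cm _ _] := nablacP.
have Gs u' v' : nablac i x u' v' = nablac i x v' u'.
  apply/eqP; rewrite -subr_eq0; have /eqP := t0 u' v'.
  by rewrite /chern_tau scaler_eq0 invr_eq0 pnatr_eq0.
have gs u' v' := Defs.metric_sym g u' v' Vx.
rewrite /fundamental_form !(metric_compat Vx _ _ _ Cm) !(chern_J2 nablacP Vx).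
have gJl' := gJl (g_bil g Vx) (fun u v => metric_J g u v Vx).
rewrite (Gs v u) (Gs w u) (Gs w v) (gJl' (nablac i x u w) v).
by rewrite (gs (nablac i x u w) (J v)); lra.
Qed.

End Vanishing.

Theorem theorem5 (R : realType) (n : nat) (M : complexManifold R n)
    (g : hermitianMetric M) (nabla nablac nablas : connection M)
    (nablaP : levi_civita g nabla) (nablacP : chern g nablac)
    (nablasP : strominger g nablas)
    (p p' : R * R) (Op : Omega p) (Op' : Omega p') (pp' : p <> p')
    (klp : kahler_like g (canonical_connection nabla nablac nablas p))
    (klp' : kahler_like g (canonical_connection nabla nablac nablas p'))
    (N1 : [set p; p'] <> [set (0, 1); (0, -1)])
    (N2 : [set p; p'] <> [set (-1, 2); (1 / 3, -2)])
    (N3 : [set p; p'] <> [set (-1, 2); (-1, 0)])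
    (N4 : [set p; p'] <> [set (1 / 3, -2); (-1, 0)]) :
  kahler g.
Proof.
move=> i x u v w ix; apply: (kahler_of_torsion_eq0 nablacP u v w ix).
move: x ix {u v w}.
(* By symmetry p is a point with s <> 0 whenever there is one. *)
wlog : p p' Op Op' pp' klp klp' N1 N2 N3 N4 / (p.2 == 0) ==> (p'.2 == 0) => [H|].
  have [s0|s0] := eqVneq p.2 0; last by apply: (H p p') => //; rewrite (negbTE s0).
  apply: (H p' p) => //; rewrite 1?setUC // ?s0 ?eqxx ?implybT //.
  by move=> e; apply: pp'.
have [s0|s0] := eqVneq p.2 0 => /= [/eqP s0'|_].
  apply: (torsion_eq0_gauduchon nablaP nablacP nablasP klp klp' s0 s0').
  (* For s = 0 one has a = 1 - r, so equal a means equal points. *)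
  apply/negP => /eqP; rewrite /canon_a s0 s0' => e; apply: pp'.
  by rewrite (surjective_pairing p) (surjective_pairing p') s0 s0'; congr (_, _); lra.
have [ex|ex] := boolP (exceptional p); last first.
  exact: (torsion_eq0_one nablaP nablacP nablasP klp s0 ex).
have points (q : R * R) : Omega q -> exceptional q ->
    (canon_a q = 1 /\ (q = (0, 1) \/ q = (0, -1)))
    \/ (canon_a q = 0 /\ (q = (-1, 2) \/ q = (1 / 3, -2))).
  move=> Oq /orP[] /andP[/eqP a1 /eqP s1]; [left|right]; split=> //; move: a1.
    have : (q.2 - 1) * (q.2 + 1) = 0 by transitivity (q.2 ^+ 2 - 1); [ring | rewrite s1 subrr].
    move/eqP; rewrite mulf_eq0 subr_eq0 addr_eq0 => /orP[] /eqP s2 a1.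
      left; rewrite (surjective_pairing q) s2; congr (_, _).
      (* At s = 1 every r gives a = 1; membership in [Omega] is what fixes r = 0. *)
      by apply: contrapT => /eqP r0; apply: Oq; split.
    right; rewrite (surjective_pairing q) s2; congr (_, _).
    by move: a1; rewrite /canon_a s2; lra.
  have : (q.2 - 2) * (q.2 + 2) = 0 by transitivity (q.2 ^+ 2 - 4); [ring | rewrite s1 subrr].
  move/eqP; rewrite mulf_eq0 subr_eq0 addr_eq0 => /orP[] /eqP s2 a1.
    left; rewrite (surjective_pairing q) s2; congr (_, _).
    by move: a1; rewrite /canon_a s2; lra.
  right; rewrite (surjective_pairing q) s2; congr (_, _).
  by move: a1; rewrite /canon_a s2; lra.
have [s0'|s0'] := eqVneq p'.2 0.
  have [[a1 _]|[a0 p2]] := points p Op ex.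
    exact: (torsion_eq0_riemannian nablaP nablacP nablasP klp klp' s0 a1 s0').
  apply: (torsion_eq0_zero nablaP nablacP nablasP klp klp' s0 a0 s0').
  apply/negP => /eqP a2.
  (* The value a = 2 at s = 0 is the Strominger connection, so the pair is one of the two excluded
     by [N3] and [N4]. *)
  have p'E : p' = (-1, 0).
    rewrite (surjective_pairing p') s0'; congr (_, _).
    by move: a2; rewrite /canon_a s0'; lra.
  by case: p2 => pE; [apply: N3|apply: N4]; rewrite pE p'E.
have [ex'|ex'] := boolP (exceptional p'); last first.
  exact: (torsion_eq0_one nablaP nablacP nablasP klp' s0' ex').
apply: (torsion_eq0_two nablaP nablacP nablasP klp klp' s0 s0').
(* Two exceptional points with the same a either coincide or form a pair excluded by [N1] or
   [N2]. *)
have [[-> pE]|[-> pE]] := points p Op ex; have [[-> pE']|[-> pE']] := points p' Op' ex'.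
- exfalso; case: pE pE' => pE [] pE'; rewrite pE pE' in pp' N1 => //.
  by apply: N1; rewrite setUC.
- exact: oner_neq0.
- by rewrite eq_sym oner_neq0.
- exfalso; case: pE pE' => pE [] pE'; rewrite pE pE' in pp' N2 => //.
  by apply: N2; rewrite setUC.
Qed.
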